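(* Let $p$ be a prime. Assume that for every finite group $H$ and every $\psi\in\operatorname{Irr}(H)$ with $a':=\nu_p(c(\psi))\ge 1$, the degree $[\mathbb{Q}_{p^{a'}}(\psi):\mathbb{Q}_p(\psi)]$ divides $\psi(1)$. Let $\mathbb{F}$ be an abelian extension of $\mathbb{Q}$, let $a:=\nu_p(c(\mathbb{F}))$, and let $b\in\mathbb{Z}_{\ge0}$. Then $\mathbb{F}$ is the field of values of an irreducible character $\chi$ of some finite group with $\nu_p(\chi(1))=b$ if and only if $\nu_p([\mathbb{F}_{p^a}:\mathbb{F}])\le b$.
   Context: $\nu_p(n)$ denotes the $p$-adic valuation of a positive integer $n$. For $n\ge1$, $\mathbb{Q}_n:=\mathbb{Q}(e^{2\pi i/n})$. For an abelian extension $\mathbb{F}/\mathbb{Q}$, the conductor $c(\mathbb{F})$ is the smallest $n\ge1$ with $\mathbb{F}\subseteq\mathbb{Q}_n$. For a field $\mathbb{F}\subseteq\mathbb{C}$ and $m\ge1$, $\mathbb{F}_m:=\mathbb{F}(e^{2\pi i/m})$. For an irreducible character $\chi$ of a finite group, $\mathbb{Q}(\chi)$ is its field of values and $c(\chi):=c(\mathbb{Q}(\chi))$; for a field $K$, $\mathbb{Q}_m(\chi)$ denotes the compositum $\mathbb{Q}_m\mathbb{Q}(\chi)$. *)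

(* Defs.v *)
From HB Require Import structures.
From mathcomp Require Import all_boot all_order all_algebra all_fingroup all_solvable all_field all_character.
Set Implicit Arguments. Unset Strict Implicit. Unset Printing Implicit Defensive.
Import GRing.Theory Num.Theory.
Local Open Scope ring_scope.

Definition subfieldC (K : algC -> Prop) : Prop :=
  [/\ K 0, K 1, (forall x y, K x -> K y -> K (x - y)),
      (forall x y, K x -> K y -> K (x * y)) & (forall x, K x -> K x^-1)].

Definition genfield (S : algC -> Prop) : algC -> Prop :=
  fun x => forall K, subfieldC K -> (forall y, S y -> K y) -> K x.

Definition QC : algC -> Prop := fun x => x \in Crat.

Definition Qcyc (n : nat) : algC -> Prop := genfield (fun z => z ^+ n = 1).

Definition adjoin_roots (F : algC -> Prop) (m : nat) : algC -> Prop :=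
  genfield (fun z => F z \/ z ^+ m = 1).

Definition field_of_values (gT : finGroupType) (G : {group gT}) (chi : 'CF(G))
  : algC -> Prop := genfield (fun z => exists g : gT, z = chi g).

Definition field_degree (K F : algC -> Prop) (n : nat) : Prop :=
  exists e : 'I_n -> algC,
    [/\ forall i, K (e i),
        (forall c : 'I_n -> algC, (forall i, F (c i)) ->
            \sum_i c i * e i = 0 -> forall i, c i = 0)
      & (forall x, K x -> exists c : 'I_n -> algC,
            (forall i, F (c i)) /\ x = \sum_i c i * e i)].

(* Finite abelian (Galois) extension of Q inside algC: finite over Q,
   stable under all automorphisms of algC (normal), and the Galois group
   (= restrictions of automorphisms of algC) is commutative. *)
Definition abelian_ext (F : algC -> Prop) : Prop :=
  [/\ subfieldC F, (exists n, field_degree F QC n),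
      (forall (s : {rmorphism algC -> algC}) x, F x -> F (s x))
    & (forall (s t : {rmorphism algC -> algC}) x, F x -> s (t x) = t (s x))].

Definition is_conductor (F : algC -> Prop) (c : nat) : Prop :=
  [/\ (0 < c)%N, (forall x, F x -> Qcyc c x)
    & forall m, (0 < m)%N -> (forall x, F x -> Qcyc m x) -> (c <= m)%N].

(* Main.v *)
(** If F lies in Q_n with n = p^a m, p not dividing m, the point is to realize
    F by a character whose degree has p-part exactly [E : F]_p, where
    E = F_{p^N} and N >= a is chosen with nu_p([E : F]) = b (the valuation of
    [F_{p^N} : F] starts at most at b, grows by at most 1 at each step, and is
    unbounded).

    All characters are induced from linear characters of subgroups, and by
    Mackey's formula irreducibility and Galois conjugacy only depend on
    intertwining.  Let K = Gal(Q_n / E), and let z_1, ..., z_k be the K-orbit of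
    a primitive m-th root of unity.  For a power q of p with m | q - 1, the
    z_i give k distinct characters of GF(q)^*, hence a linear character of
    the Borel subgroup of GL_k(q); the Bruhat decomposition shows that the
    induced character is irreducible and depends only on the set of the z_i,
    and its degree is prime to p because q is a power of p.  Multiplying
    with a faithful character of a cyclic group of order p^N gives a character
    theta of degree prime to p whose field of values is E.  In the wreath
    product by Gal(E / F), the product of the Gal(E / F)-conjugates of
    theta then induces to an irreducible character with field of values F and
    degree [E : F] theta(1)^[E : F].

    Conversely [F_p : F] < p is prime to p, so that the hypothesis on
    [F_{p^a} : F_p] bounds the p-part of [F_{p^a} : F]. *)

Require Import Defs.
From HB Require Import structures.
From mathcomp Require Import all_boot all_order all_algebra all_fingroup all_solvable all_field all_character.
From Stdlib Require Import Classical.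
Import GRing.Theory Num.Theory.
Local Open Scope ring_scope.

(** * Characters induced from linear characters *)

(** Mackey's criterion: the third clause makes the character induced by [lam]
    irreducible, and the last one says that [R s t] holds exactly when the
    conjugates of this character by [s] and [t] coincide. *)
Definition monomial_datum (gT : finGroupType) (B : {group gT})
    (lam : gT -> algC) (n : nat)
    (R : {rmorphism algC -> algC} -> {rmorphism algC -> algC} -> Prop) : Prop :=
  [/\ {in B &, {morph lam : x y / (x * y)%g >-> x * y}},
      {in B, forall t, lam t ^+ n = 1},
      (forall x : gT,
        {in B, forall t, (t ^ x)%g \in B -> lam (t ^ x)%g = lam t} -> x \in B)
    & (forall s t : {rmorphism algC -> algC}, R s t <->
         exists x : gT,
           {in B, forall u, (u ^ x)%g \in B -> s (lam u) = t (lam (u ^ x)%g)})].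

Lemma root_of_unity_neq0 (z : algC) n : (0 < n)%N -> z ^+ n = 1 -> z != 0.
Proof.
move=> n_gt0 zn; apply: contraTneq n_gt0 => z0; move: zn.
by rewrite z0 expr0n; case: n => // m /eqP; rewrite eq_sym oner_eq0.
Qed.

Section InducedLinear.

Variables (gT : finGroupType) (B : {group gT}).
Implicit Types (lam mu : gT -> algC) (D : {group gT}).

(** If [f y] differs from 1, reindexing by left multiplication by [y] shows that the sum equals
    [f y] times itself, so it vanishes. *)
Lemma sum_morph_group D (f : gT -> algC) :
    {in D &, {morph f : x y / (x * y)%g >-> x * y}} ->
  \sum_(x in D) f x = (if [forall (x | x \in D), f x == 1] then #|D|%:R else 0).
Proof.
move=> fM; case: ifPn => [/forall_inP f1|].
  by rewrite (eq_bigr (fun _ => 1)) => [|x /f1/eqP//]; rewrite sumr_const.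
rewrite negb_forall => /existsP[y]; rewrite negb_imply => /andP[Dy fy].
have : f y * (\sum_(x in D) f x) = \sum_(x in D) f x.
  rewrite big_distrr /= [RHS](reindex_inj (mulgI y)) /=.
  by apply: eq_big => [x | x Dx]; rewrite ?groupMl ?fM.
move/eqP; rewrite -{2}[\sum_(x in D) f x]mul1r -subr_eq0 -mulrBl mulf_eq0.
by rewrite subr_eq0 (negPf fy) => /eqP.
Qed.

Definition linear_rep lam (x : gT) : 'M[algC]_1 := (lam x)%:M.

Lemma linear_rep_repr lam :
    {in B &, {morph lam : x y / (x * y)%g >-> x * y}} -> lam 1%g = 1 ->
  mx_repr B (linear_rep lam).
Proof.
by move=> lamM lam1; split=> [|x y Bx By]; rewrite /linear_rep ?lam1 ?lamM ?scalar_mxM.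
Qed.

Lemma linear_at1 lam n :
    (0 < n)%N -> {in B &, {morph lam : x y / (x * y)%g >-> x * y}} ->
    {in B, forall t, lam t ^+ n = 1} -> lam 1%g = 1.
Proof.
move=> n_gt0 lamM lamn.
have nz := root_of_unity_neq0 _ _ n_gt0 (lamn _ (group1 B)).
by apply: (mulfI nz); rewrite -lamM ?mulg1 ?mulr1.
Qed.

Lemma linear_cfun lam n :
    {in B &, {morph lam : x y / (x * y)%g >-> x * y}} ->
    {in B, forall t, lam t ^+ n = 1} -> (0 < n)%N ->
  exists2 phi : 'CF(B), phi \is a character
    & forall x, phi x = if x \in B then lam x else 0.
Proof.
move=> lamM lamn n_gt0.
have lam1 := linear_at1 _ _ n_gt0 lamM lamn.
exists (cfRepr (MxRepresentation (linear_rep_repr _ lamM lam1))).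
  exact: cfRepr_char.
move=> x; rewrite cfunE /= /linear_rep mxtrace_scalar.
by case: (x \in B).
Qed.

Section Dot.
Variables (phi psi : 'CF(B)) (lam mu : gT -> algC) (n : nat).
Hypotheses (n_gt0 : (0 < n)%N)
 (phiE : forall x, phi x = if x \in B then lam x else 0)
 (psiE : forall x, psi x = if x \in B then mu x else 0)
 (lamM : {in B &, {morph lam : x y / (x * y)%g >-> x * y}})
 (muM : {in B &, {morph mu : x y / (x * y)%g >-> x * y}})
 (mun : {in B, forall t, mu t ^+ n = 1}).

Definition intertwines (y : gT) :=
  [forall (t | t \in (B :&: B :^ y^-1)%g), lam t == mu (t ^ y)%g].

(** Frobenius reciprocity and orthogonality on each [B :&: B :^ y^-1]. Summing over all elements [y]
    avoids choosing double coset representatives; the double coset of an intertwiner contributes 1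
    in total. *)
Lemma cfdot_Ind_linear :
  '['Ind[[set: gT]] phi, 'Ind[[set: gT]] psi] =
  #|B|%:R ^- 2 *
    \sum_(y | intertwines y) #|(B :&: B :^ y^-1)%g|%:R.
Proof.
rewrite -Frobenius_reciprocity cfdotE.
have -> : \sum_(x in B) phi x * (('Res[B] ('Ind[[set: gT]] psi)) x)^* =
   #|B|%:R^-1 * \sum_(y : gT) \sum_(x in (B :&: B :^ y^-1)%g) lam x * (mu (x ^ y)%g)^*.
  transitivity (\sum_(x in B) #|B|%:R^-1 * \sum_(y : gT) lam x * (psi (x ^ y)%g)^*).
    apply: eq_bigr => x Bx; rewrite phiE Bx cfResE ?subsetT // cfIndE ?subsetT //.
    rewrite rmorphM fmorphV rmorph_nat rmorph_sum /= mulrCA; congr (_ * _).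
    by rewrite big_distrr /=; apply: eq_bigl => y; rewrite inE.
  rewrite -big_distrr exchange_big /=; congr (_ * _); apply: eq_bigr => y _.
  rewrite (bigID (fun x => (x ^ y)%g \in B)) /=.
  rewrite [X in _ + X]big1 ?addr0 => [|x /andP[_ /negPf xyB]]; last first.
    by rewrite psiE xyB conjC0 mulr0.
  apply: eq_big => [x|x /andP[Bx Bxy]]; last by rewrite psiE Bxy.
  by rewrite inE mem_conjgV.
rewrite mulrA -expr2 exprVn; congr (_ * _).
rewrite [RHS]big_mkcond; apply: eq_bigr => y _.
have DB x : x \in (B :&: B :^ y^-1)%g -> x \in B /\ (x ^ y)%g \in B.
  by rewrite inE mem_conjgV => /andP[].
have norm1 x : mu x ^+ n = 1 -> `|mu x| = 1.
  move=> mx1; apply/eqP; rewrite -(@pexpr_eq1 _ _ n) //.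
  by rewrite -normrX mx1 normr1.
rewrite -/(intertwines y) (sum_morph_group _ (fun x => lam x * (mu (x ^ y)%g)^*)).
  congr (if _ then _ else _); apply: eq_forallb => x.
  case Dx: (x \in _) => //=; have [Bx Bxy] := DB x Dx.
  have mu1 := norm1 _ (mun _ Bxy).
  have munz : mu (x ^ y)%g != 0 by rewrite -normr_eq0 mu1 oner_eq0.
  (* The conjugate of a root of unity is its inverse, so the product is 1 exactly when the two
     values agree. *)
  rewrite -[(mu _)^*](mulKf munz) -normCK mu1 expr1n mulr1.
  by rewrite -[RHS](inj_eq (mulIf (invr_neq0 munz))) divff.
move=> x1 x2 Dx1 Dx2; have [? ?] := DB _ Dx1; have [? ?] := DB _ Dx2.
by rewrite conjMg lamM // muM // rmorphM /= mulrACA.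
Qed.

(** Each intertwiner contributes a positive integer to the formula above, so nothing cancels. *)
Lemma cfdot_Ind_linear_neq0 :
  reflect (exists y, {in B, forall t, (t ^ y)%g \in B -> lam t = mu (t ^ y)%g})
          ('['Ind[[set: gT]] phi, 'Ind[[set: gT]] psi] != 0).
Proof.
have Bnz : #|B|%:R ^- 2 != 0 :> algC.
  by rewrite invr_eq0 expf_eq0 /= pnatr_eq0 -lt0n cardG_gt0.
rewrite cfdot_Ind_linear mulf_eq0 (negPf Bnz) /= -natr_sum pnatr_eq0 sum_nat_eq0.
rewrite negb_forall; apply: (iffP existsP).
  case=> y; rewrite negb_imply => /andP[/forall_inP yB _]; exists y => t Bt Bty.
  by apply/eqP/yB; rewrite inE mem_conjgV Bt.
case=> y yB; exists y; rewrite negb_imply -lt0n cardG_gt0 andbT.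
by apply/forall_inP=> t; rewrite inE mem_conjgV => /andP[Bt Bty]; rewrite yB.
Qed.

End Dot.

(** By the last hypothesis the elements intertwining [lam] with itself are exactly those of [B];
    each contributes [#|B|], so the norm is 1. *)
Lemma Ind_linear_irr (phi : 'CF(B)) lam n :
    (0 < n)%N -> phi \is a character ->
    (forall x, phi x = if x \in B then lam x else 0) ->
    {in B &, {morph lam : x y / (x * y)%g >-> x * y}} ->
    {in B, forall t, lam t ^+ n = 1} ->
    (forall x : gT,
        {in B, forall t, (t ^ x)%g \in B -> lam (t ^ x)%g = lam t} -> x \in B) ->
  'Ind[[set: gT]] phi \in irr [set: gT].
Proof.
move=> n_gt0 Nphi phiE lamM lamn lamI.
rewrite irrEchar cfInd_char // (cfdot_Ind_linear phi phi lam lam n) //=.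
rewrite (eq_big (mem B) (fun _ => #|B|%:R)) => [|y|y]; first last.
- move/forall_inP=> yB; congr (#|_|)%:R.
  have By : y \in B.
    apply: lamI => t Bt Bty; apply/esym/eqP/yB.
    by rewrite inE mem_conjgV Bt.
  by rewrite conjGid ?groupV ?setIid.
- apply/forall_inP/idP => [yB | By t].
    by apply: lamI => t Bt Bty; apply/esym/eqP/yB; rewrite inE mem_conjgV Bt.
  rewrite inE mem_conjgV => /andP[Bt _].
  (* Evaluating [lam] on both sides of [t * y = y * t ^ y] and cancelling [lam y] gives invariance
     under conjugation by [y]. *)
  have := lamM _ _ By (groupJ Bt By); rewrite -conjgC lamM // => /eqP.
  have ynz := root_of_unity_neq0 _ _ n_gt0 (lamn _ By).
  by rewrite mulrC (inj_eq (mulfI ynz)).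
rewrite sumr_const -[_ *+ #|B|]mulr_natr -expr2 mulVf // expf_neq0 // pnatr_eq0 -lt0n.
exact: cardG_gt0.
Qed.

(** Conjugation by [s] commutes with induction, and two irreducible characters coincide exactly when
    their scalar product is nonzero. The explicit values serve later to place them in a cyclotomic
    field. *)
Lemma induced_datum_char lam n R :
    (0 < n)%N -> monomial_datum gT B lam n R ->
  exists i : Iirr [set: gT],
    [/\ 'chi_i 1%g = #|[set: gT] : B|%g%:R,
        (forall x, 'chi_i x =
          #|B|%:R^-1 * \sum_(y : gT) (if (x ^ y)%g \in B then lam (x ^ y)%g else 0))
      & (forall s : {rmorphism algC -> algC},
          R s idfun <-> forall x, s ('chi_i x) = 'chi_i x)].
Proof.
move=> n_gt0 [lamM lamn lamI RE].
have [phi Nphi phiE] := linear_cfun lam n lamM lamn n_gt0.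
have /irrP[i chiE] := Ind_linear_irr phi lam n n_gt0 Nphi phiE lamM lamn lamI.
have lam1 := linear_at1 _ _ n_gt0 lamM lamn.
exists i; rewrite -chiE; split.
- by rewrite cfInd1 ?subsetT // phiE group1 lam1 mulr1.
- move=> x; rewrite cfIndE ?subsetT //; congr (_ * _).
  by apply: eq_big => [y|y _]; rewrite ?inE ?phiE.
move=> s; pose phis := cfAut s phi.
have phisE x : phis x = if x \in B then s (lam x) else 0.
  by rewrite cfunE phiE; case: ifP => // _; rewrite rmorph0.
have slM : {in B &, {morph (s \o lam) : x y / (x * y)%g >-> x * y}}.
  by move=> x y Bx By; rewrite /= lamM // rmorphM.
have P := cfdot_Ind_linear_neq0 phis phi (s \o lam) lam n n_gt0 phisE phiE slM lamM lamn.
apply: (iff_trans (RE s idfun)); apply: (iff_trans (rwP P)).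
rewrite -cfAutInd chiE -aut_IirrE cfdot_irr.
rewrite pnatr_eq0 eqb0 negbK; split=> [/eqP e x | e].
  by rewrite -{2}e aut_IirrE cfunE.
by apply/eqP/irr_inj/cfunP => x; rewrite aut_IirrE cfunE e.
Qed.

End InducedLinear.

(** ['I_N.+1] is the cyclic group Z/(N+1), written multiplicatively. *)
Lemma cyclic_datum N (w : algC) : w ^+ N.+1 = 1 ->
  monomial_datum ('I_N.+1 : finGroupType) [set: 'I_N.+1]%G (fun x => w ^+ x) N.+1
    (fun s t => s w = t w).
Proof.
move=> wN; have conjI (x y : 'I_N.+1) : (x ^ y)%g = x.
  by apply/conjg_fixP/commgP; exact: GRing.addrC.
split=> [x y _ _|x _|x _|s t]; rewrite ?inE //.
- by rewrite /mulg /= expr_mod // exprD.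
- by rewrite -exprM mulnC exprM wN expr1n.
split=> [e | [x e]].
  by exists 1%g => u _ _; rewrite conjI !rmorphXn e.
(* For the trivial group [w = 1]; otherwise the residue 1 is available and tests the values of [s]
   and [t] at [w]. *)
case: N w wN x e conjI => [|N] w wN x e conjI.
  by move: wN; rewrite expr1 => ->; rewrite !rmorph1.
by have := e (inord 1); rewrite !conjI !rmorphXn /= inordK // !expr1; apply; rewrite inE.
Qed.

Section Product.
Variables (gT1 gT2 : finGroupType) (B1 : {group gT1}) (B2 : {group gT2}).

(** Intertwining is componentwise: each factor is tested on pairs whose other entry is 1, where the
    other linear character takes the value 1. *)
Lemma product_datum lam1 lam2 n R1 R2 : (0 < n)%N ->
    monomial_datum gT1 B1 lam1 n R1 -> monomial_datum gT2 B2 lam2 n R2 ->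
  monomial_datum (gT1 * gT2)%type (setX_group B1 B2)
    (fun x => lam1 x.1 * lam2 x.2) n (fun s t => R1 s t /\ R2 s t).
Proof.
move=> n_gt0 [lM1 ln1 lI1 RE1] [lM2 ln2 lI2 RE2].
have l11 := linear_at1 _ _ _ _ n_gt0 lM1 ln1.
have l21 := linear_at1 _ _ _ _ n_gt0 lM2 ln2.
have inB x : x \in setX B1 B2 = (x.1 \in B1) && (x.2 \in B2) by rewrite inE.
have J1 (x y : gT1 * gT2) : (x ^ y)%g.1 = (x.1 ^ y.1)%g by [].
have J2 (x y : gT1 * gT2) : (x ^ y)%g.2 = (x.2 ^ y.2)%g by [].
split=> [x y|x|x lx|s t].
- by rewrite !inB => /andP[? ?] /andP[? ?]; rewrite /= lM1 // lM2 // mulrACA.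
- by rewrite inB => /andP[? ?]; rewrite exprMn ln1 // ln2 // mulr1.
- rewrite inB; apply/andP; split.
    apply: lI1 => t Bt Btx; have := lx (t, 1%g).
    by rewrite !inB !J1 !J2 /= conj1g !group1 Bt Btx l21 !mulr1; apply.
  apply: lI2 => t Bt Btx; have := lx (1%g, t).
  by rewrite !inB !J1 !J2 /= conj1g !group1 Bt Btx l11 !mul1r; apply.
split=> [[/RE1[x1 e1] /RE2[x2 e2]] | [x e]].
  exists (x1, x2) => u; rewrite !inB !J1 !J2 /= => /andP[? ?] /andP[? ?].
  by rewrite !rmorphM e1 // e2.
split; [apply/RE1; exists x.1 => u Bu Bux | apply/RE2; exists x.2 => u Bu Bux].
  by have := e (u, 1%g); rewrite !inB !J1 !J2 /= conj1g !group1 Bu Bux l21 !mulr1; apply.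
by have := e (1%g, u); rewrite !inB !J1 !J2 /= conj1g !group1 Bu Bux l11 !mul1r; apply.
Qed.

Lemma index_setX :
  #|[set: (gT1 * gT2)%type] : setX_group B1 B2|%g =
    (#|[set: gT1] : B1|%g * #|[set: gT2] : B2|%g)%N.
Proof.
apply/eqP; rewrite -(eqn_pmul2l (cardG_gt0 (setX_group B1 B2))) Lagrange ?subsetT //.
rewrite /= cardsX mulnACA !Lagrange ?subsetT // -cardsX; apply/eqP.
by apply: eq_card => x; rewrite !inE.
Qed.

End Product.

(** * Wreath products and products of Galois conjugates *)

Section Wreath.
Variables (gT Q : finGroupType).

(** A separate type, so that it carries the twisted product below, in which [Q] translates the
    coordinates of the base, and not a componentwise one. *)
Definition wreath : Type := ({ffun Q -> gT} * Q)%type.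
HB.instance Definition _ := Finite.on wreath.

Definition wreath_mul (x y : wreath) : wreath :=
  ([ffun u => (x.1 u * y.1 (u * x.2))%g], (x.2 * y.2)%g).
Definition wreath_one : wreath := ([ffun=> 1%g], 1%g).
Definition wreath_inv (x : wreath) : wreath :=
  ([ffun u => (x.1 (u * x.2^-1))^-1%g], x.2^-1%g).

Lemma wreath_mulA : associative wreath_mul.
Proof.
move=> x y z; congr (_, _); last exact: mulgA.
by apply/ffunP=> u; rewrite !ffunE /= !mulgA.
Qed.

Lemma wreath_mul1 : left_id wreath_one wreath_mul.
Proof.
case=> f s; congr (_, _); last exact: mul1g.
by apply/ffunP=> u; rewrite !ffunE /= mulg1 mul1g.
Qed.

Lemma wreath_mulV : left_inverse wreath_one wreath_inv wreath_mul.
Proof.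
case=> f s; congr (_, _); last exact: mulVg.
by apply/ffunP=> u; rewrite !ffunE /= mulVg.
Qed.

HB.instance Definition _ :=
  Finite_isGroup.Build wreath wreath_mulA wreath_mul1 wreath_mulV.

Definition wreath_base (f : {ffun Q -> gT}) : wreath := (f, 1%g).

Lemma wreath_baseJ f (x : wreath) :
  (wreath_base f ^ x)%g = wreath_base [ffun u => (f (u * x.2^-1) ^ x.1 (u * x.2^-1))%g].
Proof.
rewrite conjgE; congr (_, _); last by rewrite /= mul1g mulVg.
by apply/ffunP=> u; rewrite !ffunE /= conjgE mulg1 mulgA.
Qed.

Variable B : {group gT}.

Definition wreath_sub : {set wreath} :=
  [set x : wreath | [forall u, x.1 u \in B] && (x.2 == 1%g)].

Lemma wreath_sub_group : group_set wreath_sub.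
Proof.
apply/group_setP; split=> [|x y].
  by rewrite inE eqxx andbT; apply/forallP=> u; rewrite ffunE.
rewrite !inE => /andP[/forallP xB /eqP x1] /andP[/forallP yB /eqP y1].
rewrite /= x1 y1 mulg1 eqxx andbT; apply/forallP=> u.
by rewrite ffunE groupM.
Qed.
Canonical wreath_subG := Group wreath_sub_group.

Lemma wreath_subP (x : wreath) :
  reflect (exists2 f : {ffun Q -> gT}, (forall u, f u \in B) & x = wreath_base f)
          (x \in wreath_sub).
Proof.
rewrite inE; apply: (iffP andP) => [[/forallP xB /eqP x1] | [f fB ->]].
  by exists x.1 => //; case: x x1 {xB} => f s /= ->.
by split=> //; apply/forallP.
Qed.

Lemma index_wreath :
  #|[set: wreath] : wreath_subG|%g = (#|[set: gT] : B|%g ^ #|Q| * #|Q|)%N.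
Proof.
have cardB : #|wreath_subG| = (#|B| ^ #|Q|)%N.
  transitivity #|[set wreath_base f | f : {ffun Q -> gT} in ffun_on [in B]]|.
    apply: eq_card => x; apply/wreath_subP/imsetP => -[f fB ->].
      by exists f => //; apply/ffun_onP.
    by exists f => //; apply/ffun_onP.
  by rewrite card_imset ?card_ffun_on // => f g [].
apply/eqP; rewrite -(eqn_pmul2l (cardG_gt0 wreath_subG)) Lagrange ?subsetT //.
rewrite cardB mulnA -expnMn Lagrange ?subsetT // !cardsT.
by rewrite card_prod card_ffun.
Qed.

Variables (lam : gT -> algC) (n : nat).
Variable R : {rmorphism algC -> algC} -> {rmorphism algC -> algC} -> Prop.
Hypotheses (n_gt0 : (0 < n)%N) (datB : monomial_datum gT B lam n R).
(** [sig] lists, along the group [Q], representatives of the [R]-classes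
    contained in one [R']-class. *)
Variable sig : Q -> {rmorphism algC -> algC}.
Variable R' : {rmorphism algC -> algC} -> {rmorphism algC -> algC} -> Prop.
Hypothesis sig_inj : forall u v, R (sig u) (sig v) -> u = v.
Hypothesis sig_trans : forall s t : {rmorphism algC -> algC}, R' s t ->
  exists v, forall u, R (s \o sig u) (t \o sig (u * v)%g).
Hypothesis sig_stab : forall (s t : {rmorphism algC -> algC}) u v,
  R (s \o sig u) (t \o sig v) -> R' s t.

Definition wreath_lam (x : wreath) : algC := \prod_u sig u (lam (x.1 u)).

(** Base elements concentrated at one coordinate isolate the condition there, since [lam 1 = 1];
    conversely the coordinate conditions multiply. The part [x.2] decides which two conjugates are
    compared. *)
Lemma wreath_intertwines (s t : {rmorphism algC -> algC}) (x : wreath) :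
  (forall u, {in B, forall b, (b ^ x.1 u)%g \in B ->
     s (sig u (lam b)) = t (sig (u * x.2)%g (lam (b ^ x.1 u)%g))}) <->
  {in wreath_subG, forall b, (b ^ x)%g \in wreath_subG ->
     s (wreath_lam b) = t (wreath_lam (b ^ x)%g)}.
Proof.
have [lM ln _ _] := datB; have l1 := linear_at1 _ _ _ _ n_gt0 lM ln.
split=> [e b /wreath_subP[f fB ->] /wreath_subP[g gB] | e u b Bb Bbx].
  rewrite wreath_baseJ => -[fx].
  have {gB} fxB u : (f u ^ x.1 u)%g \in B.
    by have := gB (u * x.2)%g; rewrite -fx ffunE mulgK.
  rewrite /wreath_lam !rmorph_prod /= [RHS](reindex_inj (mulIg x.2)) /=.
  by apply: eq_bigr => u _; rewrite ffunE mulgK e.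
pose f : {ffun Q -> gT} := [ffun v => if v == u then b else 1%g].
have := e (wreath_base f); rewrite wreath_baseJ /wreath_lam /=.
rewrite (bigD1 u) //= [X in _ * X]big1 ?mulr1 => [|v /negPf vu]; last first.
  by rewrite ffunE vu l1 rmorph1.
rewrite (bigD1 (u * x.2)%g) //= [X in _ * X]big1 ?mulr1 => [|v vu]; last first.
  rewrite !ffunE; case: eqP => [vux|_]; last by rewrite conj1g l1 rmorph1.
  by rewrite -vux mulgKV eqxx in vu.
rewrite !ffunE mulgK eqxx; apply; apply/wreath_subP.
  by exists f => // v; rewrite ffunE; case: ifP.
by eexists; last reflexivity; move=> v; rewrite !ffunE; case: eqP => [->|_]; rewrite ?conj1g.
Qed.

(** An element intertwining the character with itself matches [sig 1] with [sig x.2] at coordinate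
    1, so [sig_inj] puts it in the base, and its coordinates then lie in [B]. For two automorphisms,
    [sig_trans] supplies the [Q]-part of an intertwiner and the datum on [B] its coordinates; for
    the converse, [sig_stab] is applied at one coordinate. *)
Lemma wreath_datum : monomial_datum wreath wreath_subG wreath_lam n R'.
Proof.
have [lM ln lI RE] := datB; split=> [x y|x|x lx|s t].
- move=> /wreath_subP[f fB ->] /wreath_subP[g gB ->].
  rewrite /wreath_lam -big_split /=; apply: eq_bigr => u _.
  by rewrite ffunE mulg1 lM // rmorphM.
- move=> /wreath_subP[f fB ->]; rewrite /wreath_lam -prodrXl big1 // => u _.
  by rewrite -rmorphXn ln // rmorph1.
- have /wreath_intertwines e : {in wreath_subG, forall b : wreath, (b ^ x)%g \in wreath_subG ->
     idfun (wreath_lam b) = idfun (wreath_lam (b ^ x)%g)}.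
    by move=> b Bb Bbx /=; rewrite lx.
  have x1 : x.2 = 1%g.
    apply/esym; rewrite -[RHS]mul1g; apply: sig_inj; apply/RE.
    by exists (x.1 1%g); exact: e.
  apply/wreath_subP; exists x.1; last by case: (x) x1 => ? ? /= ->.
  move=> u; apply: lI => b Bb Bbx; apply: (fmorph_inj (sig u)).
  by have := e u b Bb Bbx; rewrite x1 mulg1 => /= ->.
split=> [/sig_trans[v] Rv | [x /wreath_intertwines e]]; last first.
  by apply: (@sig_stab s t 1%g (1 * x.2)%g); apply/RE; exists (x.1 1%g); exact: e.
have /fin_all_exists[f fE] : forall u, exists y : gT, {in B, forall b, (b ^ y)%g \in B ->
     (s \o sig u) (lam b) = (t \o sig (u * v)%g) (lam (b ^ y)%g)}.
  by move=> u; have [+ _] := RE (s \o sig u) (t \o sig (u * v)%g); apply; exact: Rv.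
exists ([ffun u => f u], v); apply/wreath_intertwines => u b Bb.
by rewrite ffunE; exact: fE.
Qed.

End Wreath.

(** * The Bruhat decomposition *)

Section Bruhat.

(** The indices may differ because the pivots of the Bruhat reduction can lie off the diagonal;
    permutation matrices then border to those of [lift_perm]. *)
Definition bordered_mx {K : pzRingType} n (i j : 'I_n.+1) (X : 'M[K]_n) : 'M_n.+1 :=
  \matrix_(r, c) match unlift i r, unlift j c with
    | Some r', Some c' => X r' c'
    | None, None => 1
    | _, _ => 0
    end.

Lemma bordered_mxP (K : pzRingType) n (i j : 'I_n.+1) (A : 'M[K]_n.+1) :
    A i j = 1 -> (forall r, r != i -> A r j = 0) -> (forall c, c != j -> A i c = 0) ->
  A = bordered_mx n i j (row' i (col' j A)).
Proof.
move=> A1 Ar Ac; apply/matrixP=> r c; rewrite mxE.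
case: unliftP => [r' ->|->]; case: unliftP => [c' ->|->]; rewrite ?mxE //.
  by rewrite Ar // eq_sym neq_lift.
by rewrite Ac // eq_sym neq_lift.
Qed.

Lemma mul_bordered_mx (K : pzRingType) n (i j k : 'I_n.+1) (X Y : 'M[K]_n) :
  bordered_mx n i j X *m bordered_mx n j k Y = bordered_mx n i k (X *m Y).
Proof.
apply/matrixP=> r c; rewrite !mxE (bigD1_ord j) //= !mxE unlift_none.
case Er: (unlift i r) => [r'|]; case Ec: (unlift k c) => [c'|];
  rewrite ?mul0r ?mulr0 ?mulr1 ?add0r.
- by rewrite mxE; apply: eq_bigr => l _; rewrite !mxE liftK Er Ec.
- by rewrite big1 // => l _; rewrite !mxE liftK Ec mulr0.
- by rewrite big1 // => l _; rewrite !mxE liftK Er mul0r.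
- by rewrite big1 ?addr0 // => l _; rewrite !mxE liftK Er mul0r.
Qed.

Lemma bordered_mx1 (K : pzRingType) n (i : 'I_n.+1) : bordered_mx n i i 1%:M = 1%:M :> 'M[K]_n.+1.
Proof.
apply/esym; rewrite [LHS](bordered_mxP _ _ i i) ?mxE ?eqxx //.
- by congr bordered_mx; apply/matrixP=> r c; rewrite !mxE (inj_eq lift_inj).
- by move=> r ri; rewrite mxE (negPf ri).
- by move=> c ci; rewrite mxE eq_sym (negPf ci).
Qed.

Lemma bordered_perm_mx (K : pzRingType) n (i j : 'I_n.+1) (w : 'S_n) :
  bordered_mx n i j (perm_mx w) = perm_mx (lift_perm i j w) :> 'M[K]_n.+1.
Proof.
apply/esym; rewrite [LHS](bordered_mxP _ _ i j) ?mxE ?lift_perm_id ?eqxx //.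
- by congr bordered_mx; apply/matrixP=> r c; rewrite !mxE lift_perm_lift (inj_eq lift_inj).
- by move=> r ri; rewrite !mxE -[X in _ == X](lift_perm_id i j w) (inj_eq perm_inj) (negPf ri).
- by move=> c ci; rewrite !mxE lift_perm_id eq_sym (negPf ci).
Qed.

Lemma ltn_lift n (h : 'I_n.+1) (i j : 'I_n) : (lift h i < lift h j)%N = (i < j)%N.
Proof. by rewrite !ltnNge /= leq_bump2. Qed.

Lemma trig_bordered_mx (K : pzRingType) n (i : 'I_n.+1) (X : 'M[K]_n) :
  is_trig_mx X -> is_trig_mx (bordered_mx n i i X).
Proof.
move/is_trig_mxP=> Xt; apply/is_trig_mxP=> r c; rewrite mxE.
case: unliftP => [r' ->|->]; case: unliftP => [c' ->|->] //; last by rewrite ltnn.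
by rewrite ltn_lift; apply: Xt.
Qed.

Variable K : fieldType.

(** If the bordered matrix is invertible, deleting row [j] and column [i] from its inverse leaves an
    inverse of [X]. *)
Lemma unit_bordered_mx n (i j : 'I_n.+1) (X : 'M[K]_n) :
  (bordered_mx n i j X \in unitmx) = (X \in unitmx).
Proof.
apply/idP/idP=> Xu; last first.
  have XV : bordered_mx n i j X *m bordered_mx n j i (invmx X) = 1%:M.
    by rewrite mul_bordered_mx mulmxV ?bordered_mx1.
  by case: (mulmx1_unit XV).
suff /mulmx1_unit[] : X *m row' j (col' i (invmx (bordered_mx n i j X))) = 1%:M by [].
apply/matrixP=> r c; have /matrixP/(_ (lift i r) (lift i c)) := mulmxV Xu.
rewrite !mxE (bigD1_ord j) //= [X in X * _]mxE liftK unlift_none mul0r add0r.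
rewrite (inj_eq lift_inj) => <-; apply: eq_bigr => l _.
by rewrite !mxE !liftK.
Qed.

Lemma unit_trig_mx n (X : 'M[K]_n) :
  is_trig_mx X -> (forall i, X i i != 0) -> X \in unitmx.
Proof.
move=> Xt Xd; rewrite unitmxE det_trig // unitfE.
by rewrite prodf_seq_neq0; apply/allP=> i _; rewrite Xd.
Qed.

Lemma diag_mul_trig_mx n (X Y : 'M[K]_n) i :
  is_trig_mx X -> is_trig_mx Y -> (X *m Y) i i = X i i * Y i i.
Proof.
move=> /is_trig_mxP Xt /is_trig_mxP Yt; rewrite mxE (bigD1 i) //= big1 ?addr0 // => k ki.
have [ik|ik] := ltnP i k; first by rewrite Xt ?mul0r.
by rewrite Yt ?mulr0 // ltn_neqAle ik andbT.
Qed.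

Lemma trig_mulmx n (X Y : 'M[K]_n) :
  is_trig_mx X -> is_trig_mx Y -> is_trig_mx (X *m Y).
Proof.
move=> /is_trig_mxP Xt /is_trig_mxP Yt; apply/is_trig_mxP=> r c rc; rewrite mxE big1 // => k _.
have [rk|rk] := ltnP r k; first by rewrite Xt ?mul0r.
by rewrite Yt ?mulr0 // (leq_ltn_trans rk).
Qed.

(** Clear the last column with its topmost nonzero entry as pivot, then the
    pivot row, and recurse on the complementary minor. *)
Lemma bruhat n (A : 'M[K]_n) : A \in unitmx ->
  exists L1 L2 (w : 'S_n), [/\ is_trig_mx L1, is_trig_mx L2, L1 \in unitmx,
    L2 \in unitmx & L1 *m A *m L2 = perm_mx w].
Proof.
elim: n => [|n IHn] in A *.
  move=> _; exists 1%:M, 1%:M, 1%g.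
  by split; rewrite ?scalar_mx_is_trig ?unitmx1 //; apply/matrixP=> -[].
move=> Au; have [i0 Ai0] : exists i, A i ord_max != 0.
  apply/existsP; apply: contraLR Au; rewrite negb_exists => /forallP A0.
  rewrite unitmxE (expand_det_col _ ord_max) big1 ?unitr0 // => i _.
  by have := A0 i; rewrite negbK => /eqP->; rewrite mul0r.
pose m : 'I_n.+1 := ord_max; rewrite -/m in Ai0.
have [i Ai Amin] : exists2 i, A i m != 0 & forall r : 'I_n.+1, (r < i)%N -> A r m = 0.
  case: (@arg_minnP _ i0 (fun i => A i m != 0) val Ai0) => i Ai iP; exists i => // r ri.
  by apply/eqP; apply: contraTT ri => /iP; rewrite -leqNgt.
(* Left multiplication by [L1] scales the pivot row and subtracts multiples of it from the rows
   below. The rows above already vanish in the last column, which makes [L1] lower triangular. *)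
pose L1 : 'M[K]_n.+1 := \matrix_(r, c)
  if c == i then (if r == i then (A i m)^-1 else - A r m / A i m) else (r == c)%:R.
have L1t : is_trig_mx L1.
  apply/is_trig_mxP=> r c rc; rewrite mxE.
  have /negPf rNc : r != c by rewrite neq_ltn rc.
  case: eqP => [ci|_]; last by rewrite rNc.
  by move: rc rNc; rewrite ci => ri ->; rewrite Amin // oppr0 mul0r.
have L1u : L1 \in unitmx.
  by apply: unit_trig_mx => // r; rewrite mxE eqxx; case: (r == i); rewrite ?invr_neq0 ?oner_eq0.
pose A1 := L1 *m A.
have A1E r c : A1 r c = if r == i then A i c / A i m else A r c - A r m / A i m * A i c.
  rewrite mxE (bigD1 i) //= mxE eqxx; case: ifP => [/eqP-> | ri].
    rewrite big1 ?addr0 1?mulrC // => k ki.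
    by rewrite mxE (negPf ki) eq_sym (negPf ki) mul0r.
  rewrite (bigD1 r) ?ri //= mxE ri eqxx mul1r big1 ?addr0 => [|k /andP[ki kr]].
    by rewrite addrC !mulNr.
  by rewrite mxE (negPf ki) eq_sym (negPf kr) mul0r.
(* Right multiplication by [L2] clears the pivot row by means of the last column. Only the last row
   of [L2] has nonzero off-diagonal entries, so it is lower triangular too. *)
pose L2 : 'M[K]_n.+1 := \matrix_(r, c)
  if r == m then (if c == m then 1 else - A1 i c) else (r == c)%:R.
have L2t : is_trig_mx L2.
  apply/is_trig_mxP=> r c rc; rewrite mxE.
  have /negPf-> : r != m by rewrite neq_ltn /= (leq_trans rc) // -ltnS.
  by have /negPf-> : r != c by rewrite neq_ltn rc.
have L2u : L2 \in unitmx.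
  by apply: unit_trig_mx => // r; rewrite mxE eqxx; case: (r == m); rewrite ?oner_eq0.
pose A2 := A1 *m L2.
have A2E r c : A2 r c = if c == m then A1 r m else A1 r c - A1 r m * A1 i c.
  rewrite mxE (bigD1 m) //= [L2 m c]mxE eqxx; case: ifP => [/eqP-> | cm].
    by rewrite mulr1 big1 ?addr0 // => k km; rewrite [L2 k m]mxE (negPf km) mulr0.
  rewrite (bigD1 c) ?cm //= [L2 c c]mxE cm eqxx mulr1 big1 ?addr0 => [|k /andP[km kc]].
    by rewrite addrC mulrN.
  by rewrite [L2 k c]mxE (negPf km) (negPf kc) mulr0.
have A1i : A1 i m = 1 by rewrite A1E eqxx divff.
have A2B : A2 = bordered_mx n i m (row' i (col' m A2)).
  apply: bordered_mxP => [|r ri|c cm]; rewrite A2E ?eqxx //.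
    by rewrite A1E (negPf ri) divfK ?subrr.
  by rewrite (negPf cm) A1i mul1r subrr.
have A2u : A2 \in unitmx by rewrite !unitmx_mul L1u Au.
rewrite A2B unit_bordered_mx in A2u.
have [M1 [M2 [w [M1t M2t M1u M2u Mw]]]] := IHn _ A2u.
exists (bordered_mx n i i M1 *m L1), (L2 *m bordered_mx n m m M2), (lift_perm i m w).
split.
- by apply: trig_mulmx; rewrite ?trig_bordered_mx.
- by apply: trig_mulmx; rewrite ?trig_bordered_mx.
- by rewrite unitmx_mul unit_bordered_mx M1u.
- by rewrite unitmx_mul unit_bordered_mx M2u L2u.
rewrite -bordered_perm_mx -Mw -(mul_bordered_mx _ _ i m m) -(mul_bordered_mx _ _ i i m) -A2B.
by rewrite /A2 /A1 !mulmxA.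
Qed.

End Bruhat.

(** * Principal series of GL_n *)

(** The multiplicative group is cyclic because its elements are [#|K|.-1] distinct roots of
    [X^(#|K|.-1) - 1]. The value of [f] at 0 is arbitrary. *)
Lemma discrete_log (K : finFieldType) :
  exists (g : K) (f : K -> nat),
    (#|K|.-1).-primitive_root g /\ forall x, x != 0 -> g ^+ f x = x.
Proof.
have q1 : (0 < #|K|.-1)%N by rewrite -subn1 subn_gt0 finNzRing_gt1.
have U x : x != 0 -> x ^+ #|K|.-1 = 1 :> K.
  move=> x0; apply: (mulfI x0); rewrite mulr1 -exprS prednK ?expf_card //.
  exact: ltnW (finNzRing_gt1 K).
pose rs := [seq x <- enum K | x != 0].
have /hasP[g _ gP] : has (#|K|.-1).-primitive_root rs.
  apply: has_prim_root => //.
  - apply/allP=> x; rewrite mem_filter => /andP[x0 _].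
    by apply/unity_rootP; exact: U.
  - by rewrite filter_uniq ?enum_uniq.
  rewrite -(cardC1 (0 : K)) cardE /enum_mem !size_filter -enumT.
  by apply/eq_leq/eq_count => x; rewrite !inE.
have [f fP] : exists f : K -> nat, forall x, x != 0 -> g ^+ f x = x.
  apply: (@fin_all_exists K (fun _ => nat) (fun x k => x != 0 -> g ^+ k = x)) => x.
  have [->|x0] := eqVneq x 0; first by exists 0%N.
  by have [i ->] := prim_rootP gP (U x x0); exists i.
by exists g, f.
Qed.

Section Borel.

Variables (K : finFieldType) (n : nat).
(** Naming the finGroupType keeps unification from unfolding the matrix unit group. *)
Definition GL_finGroup : finGroupType := {'GL_n.+1[K]}.
Local Notation gT := GL_finGroup.
Implicit Types x y : gT.

Definition GL_mx (x : gT) : 'M[K]_n.+1 := GLval x.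

Lemma GL_mxM x y : GL_mx (x * y)%g = GL_mx x *m GL_mx y. Proof. by []. Qed.

Definition borel : {set gT} := [set x | is_trig_mx (GL_mx x)].

Lemma borel_group : group_set borel.
Proof.
apply/group_setP; split=> [|x y]; rewrite !inE; first exact: scalar_mx_is_trig.
by move=> xt yt; rewrite GL_mxM; apply: trig_mulmx.
Qed.
Definition borelG : {group gT} := Group borel_group.

Lemma in_borelG x : (x \in borelG) = is_trig_mx (GL_mx x).
Proof. by rewrite inE. Qed.

Lemma GL_conjE x y : (GL_mx y *m GL_mx (x ^ y)%g = GL_mx x *m GL_mx y).
Proof. by rewrite -!GL_mxM -conjgC. Qed.

Lemma borel_diag_neq0 x i : x \in borelG -> GL_mx x i i != 0.
Proof.
rewrite in_borelG => xt; have := GL_det x; rewrite det_trig //; apply: contra => xi0.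
by rewrite (bigD1 i) //= (eqP xi0) mul0r.
Qed.

(** The entries strictly below the diagonal are free, and they number ['C(n.+1, 2)]. *)
Lemma card_borel_dvd : (#|K| ^ 'C(n.+1, 2) %| #|borelG|)%N.
Proof.
pose F (ij : 'I_n.+1 * 'I_n.+1) : pred K :=
  if (ij.1 < ij.2)%N then pred1 0 else if ij.1 == ij.2 then predC1 0 else predT.
pose phi (f : {ffun 'I_n.+1 * 'I_n.+1 -> K}) : 'M[K]_n.+1 := \matrix_(i, j) f (i, j).
have phi_inj : injective phi.
  move=> f g /matrixP e; apply/ffunP=> -[i j].
  by have := e i j; rewrite !mxE.
have -> : #|borelG| = #|family F|.
  rewrite -(card_imset _ phi_inj) -(card_imset borelG (@val_inj _ _ gT)).
  apply: eq_card => A; apply/imsetP/imsetP => -[].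
    move=> x Bx ->; exists [ffun ij => GL_mx x ij.1 ij.2]; last first.
      by apply/matrixP=> i j; rewrite mxE ffunE.
    apply/familyP=> -[i j]; rewrite ffunE /F /=; case: ifP => [ij | _].
      by move: Bx; rewrite in_borelG => /is_trig_mxP/(_ _ _ ij) ->; rewrite inE.
    by case: eqP => [<-|//]; rewrite !inE borel_diag_neq0.
  move=> f /familyP fF ->.
  have ft : is_trig_mx (phi f).
    by apply/is_trig_mxP=> i j ij; have := fF (i, j); rewrite mxE /F /= ij => /eqP.
  have fu : phi f \in unitmx.
    apply: unit_trig_mx => // i; have := fF (i, i).
    by rewrite mxE /F /= ltnn eqxx.
  by exists (FinRing.unit _ fu : gT); rewrite ?in_borelG.
rewrite card_family .
have -> : foldr muln 1%N [seq #|F x| | x : 'I_n.+1 * 'I_n.+1] = (\prod_ij #|F ij|)%N.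
  by rewrite foldrE big_map big_enum.
rewrite (bigID (fun ij : 'I_n.+1 * 'I_n.+1 => (ij.2 < ij.1)%N)) /=; apply: dvdn_mulr.
rewrite (eq_bigr (fun _ => #|K|)) => [|[i j] /= ji]; last first.
  by rewrite /F /= ltnNge (ltnW ji) /= eq_sym -val_eqE /= ltn_eqF.
rewrite -(pair_big_dep xpredT (fun i j : 'I_n.+1 => (j < i)%N) (fun _ _ => #|K|)) /=.
rewrite -bin2_sum big_mkord (eq_bigr (fun i : 'I_n.+1 => (#|K| ^ i)%N)) => [|i _].
  by rewrite -(big_morph _ (expnD #|K|) (expn0 _)) dvdnn.
by rewrite -(big_ord_widen _ (fun _ => #|K|)) ?prod_nat_const ?card_ord // ltnW.
Qed.

(** The subgroup absorbs the power of [#|K|] in the order of GL, so the index divides a product of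
    numbers [#|K| ^ i - 1], all congruent to -1 modulo [p]. *)
Lemma index_borel p : prime p -> (p %| #|K|)%N ->
  coprime p #|[set: gT] : borelG|%g.
Proof.
move=> pr_p pK; have /dvdnP[m mE] := card_borel_dvd.
have K0 : (0 < #|K| ^ 'C(n.+1, 2))%N by rewrite expn_gt0 (ltnW (finNzRing_gt1 K)).
have : (#|[set: gT] : borelG|%g %| \prod_(1 <= i < n.+2) (#|K| ^ i - 1))%N.
  apply/dvdnP; exists m; apply/eqP; rewrite -(eqn_pmul2l K0).
  by rewrite -card_GL // mulnA [(_ ^ _ * m)%N]mulnC -mE Lagrange ?subsetT.
move/coprime_dvdr; apply; rewrite big_nat_cond.
apply: (big_ind (coprime p)) => [|a b pa pb|i /andP[/andP[i1 _] _]].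
- exact: coprimen1.
- by rewrite coprimeMr pa.
rewrite prime_coprime //; apply/negP; rewrite -(prednK i1) expnS.
have pq := dvdn_mulr (#|K| ^ i.-1) pK.
rewrite dvdn_subr ?dvdn1 //; first by case: (p) pr_p => [|[|]].
by rewrite muln_gt0 expn_gt0 (ltnW (finNzRing_gt1 K)).
Qed.

Variables (g : K) (dlog : K -> nat).
Hypotheses (gP : (#|K|.-1).-primitive_root g) (dlogP : forall a : K, a != 0 -> g ^+ dlog a = a).

(** [z ^+ dlog a] is the value at [a] of the character of the multiplicative
    group of [K] that sends the generator [g] to [z]. *)
Section Dlog.
Variable z : algC.
Hypothesis zK : z ^+ #|K|.-1 = 1.

Lemma expr_dlog a b : g ^+ a = g ^+ b -> z ^+ a = z ^+ b.
Proof.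
by move/eqP; rewrite (eq_prim_root_expr gP) => /eqP ab; rewrite -(expr_mod a zK) ab expr_mod.
Qed.

Lemma expr_dlogM (a b : K) : a != 0 -> b != 0 ->
  z ^+ dlog (a * b) = z ^+ dlog a * z ^+ dlog b.
Proof.
by move=> a0 b0; rewrite -exprD; apply: expr_dlog; rewrite exprD !dlogP // mulf_neq0.
Qed.

Lemma expr_dlog1 : z ^+ dlog 1 = 1.
Proof. by rewrite -[RHS](expr0 z); apply: expr_dlog; rewrite dlogP ?oner_eq0. Qed.

Lemma expr_dlog_gen : z ^+ dlog g = z.
Proof.
rewrite -[RHS]expr1; apply: expr_dlog; rewrite dlogP ?expr1 //.
by rewrite (prim_root_eq0 gP) -lt0n (prim_order_gt0 gP).
Qed.

End Dlog.

Variables (z : 'I_n.+1 -> algC) (N : nat).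
Hypotheses (z_inj : injective z) (zK : forall i, z i ^+ #|K|.-1 = 1)
  (zN : forall i, z i ^+ N = 1).

(** A character of the diagonal torus, inflated to the Borel subgroup. *)
Definition borel_lam x := \prod_i z i ^+ dlog (GL_mx x i i).

Lemma borel_lamM : {in borelG &, {morph borel_lam : x y / (x * y)%g >-> x * y}}.
Proof.
move=> x y Bx By; rewrite /borel_lam -big_split; apply: eq_bigr => i _.
rewrite GL_mxM diag_mul_trig_mx ?expr_dlogM ?borel_diag_neq0 //.
  by move: Bx; rewrite in_borelG.
by move: By; rewrite in_borelG.
Qed.

Lemma borel_lamN : {in borelG, forall x, borel_lam x ^+ N = 1}.
Proof.
move=> x _; rewrite -prodrXl big1 // => i _.
by rewrite -exprM mulnC exprM zN expr1n.
Qed.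

Lemma borel_lamJ x y : x \in borelG -> y \in borelG -> borel_lam (x ^ y)%g = borel_lam x.
Proof.
move=> Bx By; have ynz : borel_lam y != 0.
  rewrite prodf_seq_neq0; apply/allP=> i _ /=; apply: expf_neq0.
  by apply: root_of_unity_neq0 (zK i); exact: prim_order_gt0 gP.
have Bxy : (x ^ y)%g \in borelG := groupJ Bx By.
apply: (mulfI ynz); have := borel_lamM y (x ^ y)%g By Bxy.
by rewrite -conjgC (borel_lamM x y Bx By) mulrC => ->.
Qed.

(** A torus element at which the linear character takes the single value [z i], so that intertwining
    can be tested one index at a time. *)
Definition diag_gen (i : 'I_n.+1) : 'M[K]_n.+1 :=
  diag_mx (\row_j if j == i then g else 1).

Lemma diag_gen_unit i : diag_gen i \in unitmx.
Proof.
apply: unit_trig_mx; first exact/is_diag_mx_is_trig/diag_mx_is_diag.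
move=> j; rewrite !mxE eqxx; case: ifP; rewrite ?oner_eq0 //.
by rewrite (prim_root_eq0 gP) -lt0n (prim_order_gt0 gP).
Qed.

Definition GL_diag_gen i : gT := FinRing.unit _ (diag_gen_unit i).

Lemma diag_gen_borel i : GL_diag_gen i \in borelG.
Proof. by rewrite in_borelG; exact/is_diag_mx_is_trig/diag_mx_is_diag. Qed.

Lemma diag_gen_lam i : borel_lam (GL_diag_gen i) = z i.
Proof.
rewrite /borel_lam (bigD1 i) //= big1 => [|j /negPf ji].
  by rewrite mulr1 /GL_mx /= !mxE !eqxx expr_dlog_gen.
by rewrite /GL_mx /= !mxE eqxx ji expr_dlog1.
Qed.

Definition GL_perm (w : 'S_n.+1) : gT := FinRing.unit _ (unitmx_perm K w).

Lemma diag_genJ i w : (GL_diag_gen i ^ GL_perm w)%g = GL_diag_gen (w i).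
Proof.
apply: (mulgI (GL_perm w)); rewrite -conjgC; apply: val_inj => /=.
change (diag_gen i *m perm_mx w = perm_mx w *m diag_gen (w i)).
apply/matrixP=> r c; rewrite mul_diag_mx mul_mx_diag !mxE.
case: (w r =P c) => [<-|]; rewrite ?mulr0 ?mul0r // mulr1 mul1r.
by rewrite (inj_eq perm_inj).
Qed.

(** Bruhat turns [l1 * x * l2] into a permutation matrix. Conjugation by [l1] and [l2] inside the
    Borel subgroup does not change the linear character, so testing [x] on the conjugates by [l1] of
    the diagonal generators compares [z i] with [z (w i)]. *)
Lemma borel_intertwines_perm (s t : {rmorphism algC -> algC}) x :
    {in borelG, forall b, (b ^ x)%g \in borelG ->
       s (borel_lam b) = t (borel_lam (b ^ x)%g)} ->
  exists2 w : 'S_n.+1, forall i, s (z i) = t (z (w i)) & w = 1%g -> x \in borelG.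
Proof.
move=> e; have [L1 [L2 [w [L1t L2t L1u L2u Lw]]]] := bruhat _ _ (GL_mx x) (valP x).
pose l1 : gT := FinRing.unit _ L1u; pose l2 : gT := FinRing.unit _ L2u.
have Bl1 : l1 \in borelG by rewrite in_borelG.
have Bl2 : l2 \in borelG by rewrite in_borelG.
have BV2 : l2^-1%g \in borelG by rewrite groupV.
have xE : (l1 * x * l2)%g = GL_perm w by apply: val_inj.
exists w => [i|w1].
  have Bi := diag_gen_borel i; have Bwi := diag_gen_borel (w i).
  have J : ((GL_diag_gen i ^ l1) ^ x)%g = (GL_diag_gen (w i) ^ l2^-1)%g.
    by rewrite -diag_genJ -xE -!conjgM mulgK.
  have BiJ : (GL_diag_gen i ^ l1)%g \in borelG := groupJ Bi Bl1.
  have BwJ : (GL_diag_gen (w i) ^ l2^-1)%g \in borelG := groupJ Bwi BV2.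
  have := e _ BiJ; rewrite J => /(_ BwJ).
  rewrite (borel_lamJ _ _ Bi Bl1) (borel_lamJ _ _ Bwi BV2).
  by rewrite (diag_gen_lam i) (diag_gen_lam (w i)).
have : GL_perm w \in borelG by rewrite w1 in_borelG /GL_mx /= perm_mx1 scalar_mx_is_trig.
by rewrite -xE (groupMr _ Bl2) (groupMl _ Bl1).
Qed.

Lemma borel_perm_intertwines (s t : {rmorphism algC -> algC}) (w : 'S_n.+1) :
    (forall i, s (z i) = t (z (w i))) ->
  {in borelG, forall b, (b ^ GL_perm w)%g \in borelG ->
     s (borel_lam b) = t (borel_lam (b ^ GL_perm w)%g)}.
Proof.
move=> e b Bb _; rewrite !rmorph_prod [RHS](reindex_inj (@perm_inj _ w)).
apply: eq_bigr => i _; rewrite !rmorphXn e; congr (_ ^+ dlog _).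
(* This entry identifies the diagonal entry of the conjugate at [w i] with that of [b] at [i]. *)
have : (perm_mx w *m GL_mx (b ^ GL_perm w)%g) i (w i) = (GL_mx b *m perm_mx w) i (w i).
  by have /matrixP := GL_conjE b (GL_perm w); apply.
rewrite -row_permE mxE => ->; rewrite mxE (bigD1 i) //= big1 ?addr0 => [|j ji].
  by rewrite !mxE eqxx mulr1.
by rewrite !mxE (inj_eq perm_inj) (negPf ji) mulr0.
Qed.

(** Distinctness of the [z i] forces [w = 1] when the character is intertwined with itself. In the
    last clause an inclusion of finite sets of conjugates suffices: the index map is injective,
    hence a permutation. *)
Lemma borel_datum :
  monomial_datum gT borelG borel_lam N (fun s t => forall i, exists j, s (z i) = t (z j)).
Proof.
split=> [||x e|s t]; [exact: borel_lamM | exact: borel_lamN | | split].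
- have [b Bb Bbx|w wz] := borel_intertwines_perm idfun idfun x; first by rewrite /= e.
  by apply; apply/permP=> i; rewrite perm1; apply: z_inj; exact/esym/(wz i).
- case/fin_all_exists=> f fE.
  have f_inj : injective f.
    by move=> i j fij; apply/z_inj/(fmorph_inj s); rewrite !fE fij.
  exists (GL_perm (perm f_inj)); apply: borel_perm_intertwines => i.
  by rewrite permE fE.
case=> x e i; have [w wz _] := borel_intertwines_perm s t x e.
by exists (w i); exact: wz.
Qed.

End Borel.

Lemma monomial_datum_dvd (gT : finGroupType) (B : {group gT}) lam n n' R :
  (n %| n')%N -> monomial_datum gT B lam n R -> monomial_datum gT B lam n' R.
Proof.
case/dvdnP=> k -> [lM ln lI RE]; split=> // t Bt.
by rewrite mulnC exprM ln // expr1n.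
Qed.

Lemma monomial_datum_iff (gT : finGroupType) (B : {group gT}) lam n R R' :
  (forall s t, R s t <-> R' s t) -> monomial_datum gT B lam n R ->
  monomial_datum gT B lam n R'.
Proof. by move=> RR [lM ln lI RE]; split=> // s t; rewrite -RE; apply: iff_sym. Qed.

Lemma borel_datum_exists p m n k (z : 'I_k.+1 -> algC) :
    prime p -> coprime p m -> (0 < m)%N -> (m %| n)%N ->
    injective z -> (forall i, z i ^+ m = 1) ->
  exists (gT : finGroupType) (B : {group gT}) lam,
    monomial_datum gT B lam n (fun s t => forall i, exists j, s (z i) = t (z j))
    /\ coprime p #|[set: gT] : B|%g.
Proof.
move=> pr_p pm m_gt0 mn z_inj zm.
have phi_gt0 : (0 < totient m)%N by rewrite totient_gt0.
(* With [#|K| = p ^ totient m], Euler's theorem makes [m] divide [#|K|.-1]. *)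
have [K _ cardK] := pPrimePowerField pr_p phi_gt0.
have mK : (m %| #|K|.-1)%N.
  rewrite cardK -subn1 -eqn_mod_dvd ?expn_gt0 ?prime_gt0 //.
  exact/eqP/Euler_exp_totient.
have [g [dlog [gP dlogP]]] := discrete_log K.
have zD d i : (m %| d)%N -> z i ^+ d = 1.
  by case/dvdnP=> e ->; rewrite mulnC exprM zm expr1n.
exists (GL_finGroup K k), (borelG K k), (borel_lam K k dlog z); split.
  by apply: (borel_datum K k g dlog gP dlogP z n z_inj) => i; apply: zD.
apply: index_borel => //; rewrite cardK -(prednK phi_gt0) expnS.
exact: dvdn_mulr.
Qed.

(** * Subfields of the algebraic numbers *)

Lemma subfieldC_D (K : algC -> Prop) x y : subfieldC K -> K x -> K y -> K (x + y).
Proof. by case=> K0 _ KB _ _ Kx Ky; rewrite -[y]opprK -[- y]sub0r; apply/KB/KB. Qed.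

Lemma subfieldC_rat (K : algC -> Prop) (a : rat) : subfieldC K -> K (ratr a).
Proof.
move=> sK; have [K0 K1 KB KM KV] := sK.
have Kn n : K n%:R by elim: n => // n IHn; rewrite -addn1 natrD; exact: subfieldC_D.
have Kz (m : int) : K m%:~R.
  by case: (intP m) => // n; rewrite ?mulrNz -?pmulrn // -[- _]sub0r; exact: KB.
by rewrite /ratr; apply: KM => //; apply: KV.
Qed.

Lemma genfield_subfield S : subfieldC (genfield S).
Proof.
split.
- by move=> K [].
- by move=> K [].
- by move=> x y Sx Sy K sK SK; have [_ _ KB _ _] := sK; apply: KB; [exact: Sx | exact: Sy].
- by move=> x y Sx Sy K sK SK; have [_ _ _ KM _] := sK; apply: KM; [exact: Sx | exact: Sy].
- by move=> x Sx K sK SK; have [_ _ _ _ KV] := sK; apply: KV; exact: Sx.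
Qed.

Lemma genfield_gen (S : algC -> Prop) x : S x -> genfield S x.
Proof. by move=> Sx K _; apply. Qed.

Lemma eq_genfield (S T : algC -> Prop) :
  (forall x, S x <-> T x) -> forall x, genfield S x <-> genfield T x.
Proof. by move=> ST x; split=> gx K sK KS; apply: gx => // y /ST; apply: KS. Qed.

Lemma eq_field_degree (K K' F F' : algC -> Prop) d :
    (forall x, K x <-> K' x) -> (forall x, F x <-> F' x) ->
  field_degree K F d -> field_degree K' F' d.
Proof.
move=> KK FF [e [eK eI eS]]; exists e; split=> [i|c Fc|x /KK/eS[c [Fc ->]]].
- exact/KK.
- by apply: eI => i; apply/FF.
by exists c; split=> // i; apply/FF.
Qed.

Lemma agree_subfield (s t : {rmorphism algC -> algC}) : subfieldC (fun x => s x = t x).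
Proof.
split=> [||x y xs ys|x y xs ys|x xs]; rewrite ?rmorph0 ?rmorph1 //.
- by rewrite !rmorphB xs ys.
- by rewrite !rmorphM xs ys.
- by rewrite !fmorphV xs.
Qed.

(** * Number fields embedded in [algC] *)

Section NumberField.

Variables (L : fieldExtType rat) (LC : {rmorphism L -> algC}).
Implicit Types (U V : {subfield L}) (K : algC -> Prop).

Definition imageC (U : {vspace L}) : algC -> Prop := fun x => exists2 y, y \in U & x = LC y.

Lemma imageCP (U : {vspace L}) y : imageC U (LC y) <-> y \in U.
Proof. by split=> [[z Uz /fmorph_inj->] | Uy] //; exists y. Qed.

Lemma imageC_subfield U : subfieldC (imageC U).
Proof.
split.
- by exists 0; rewrite ?mem0v ?rmorph0.
- by exists 1; rewrite ?mem1v ?rmorph1.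
- by move=> _ _ [x Ux ->] [y Uy ->]; exists (x - y); rewrite ?rpredB ?rmorphB.
- by move=> _ _ [x Ux ->] [y Uy ->]; exists (x * y); rewrite ?rpredM ?rmorphM.
- by move=> _ [x Ux ->]; exists x^-1; rewrite ?rpredV ?fmorphV.
Qed.

(** Membership in [K] is a mere proposition, so the preimage is obtained by enlarging a subspace one
    vector at a time, with excluded middle at each step; the dimension of [L] bounds the process. *)
Lemma subfieldC_preimage K : subfieldC K ->
  exists U : {subfield L}, forall y, y \in U <-> K (LC y).
Proof.
move=> sK; have [K0 K1 KB KM KV] := sK.
suff [U UK] : exists U : {vspace L}, forall y, y \in U <-> K (LC y).
  have aU : is_aspace U.
    apply/andP; split; first by apply/has_algid1/UK; rewrite rmorph1.
    by apply/prodvP=> x y /UK Kx /UK Ky; apply/UK; rewrite rmorphM; apply: KM.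
  by exists (ASpace aU).
have maxU k (U : {vspace L}) : (forall y, y \in U -> K (LC y)) ->
    (\dim {:L} < \dim U + k)%N -> exists U : {vspace L}, forall y, y \in U <-> K (LC y).
  elim: k U => [|k IHk] U UK Uk.
    by move: Uk; rewrite addn0 ltnNge dimvS ?subvf.
  case: (classic (exists2 y, K (LC y) & y \notin U)) => [[y Ky yU] | noy]; last first.
    exists U => y; split=> [|Ky]; first exact: UK.
    by case yU: (y \in U) => //; case: noy; exists y; rewrite ?yU.
  apply: (IHk (U + <[y]>)%VS) => [_ /memv_addP[u Uu [_ /vlineP[a ->] ->]] | ].
    rewrite rmorphD rmorphZ_num; apply: subfieldC_D => //; first exact: UK.
    by apply: KM => //; apply: subfieldC_rat.
  apply: leq_trans Uk _; rewrite addnS -addSn leq_add2r.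
  have [dU dUe] := dimv_leqif_eq (addvSl U <[y]>).
  rewrite ltn_neqAle dU dUe andbT; apply: contra yU => /eqP->.
  by apply: (subvP (addvSr U <[y]>)); exact: memv_line.
apply: (maxU (\dim {:L}).+1 0%VS) => [y|]; last by rewrite dimv0 add0n.
by rewrite memv0 => /eqP->; rewrite rmorph0.
Qed.

Lemma imageC_1 x : QC x <-> imageC 1%VS x.
Proof.
split=> [/CratP[a ->] | [_ /vlineP[a ->] ->]].
  by exists a%:A; rewrite ?memvZ ?mem1v // rmorphZ_num rmorph1 mulr1.
by rewrite rmorphZ_num rmorph1 mulr1; exact: Crat_rat.
Qed.

Lemma field_degree_dim U V : (U <= V)%VS -> field_degree (imageC V) (imageC U) (\dim_U V).
Proof.
move=> sUV; have UVV : (U * V <= V)%VS by rewrite sup_field_module.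
have [X [XV X0] [] ] := field_module_semisimple UVV; set m := \dim_U V.
move=> defV dirV; exists (fun i : 'I_m => LC X`_i); split.
- by move=> i; apply/imageCP/XV; rewrite mem_nth ?size_tuple.
- move=> c /fin_all_exists2[u uU cE] s0 i; rewrite cE.
  have /eqP : u i * X`_i = 0.
    have /directv_sum_independent dX := dirV.
    apply: (dX (fun j : 'I_m => u j * X`_j)) => // [j _|].
      by rewrite memv_mul // memv_line.
    apply: (fmorph_inj LC); rewrite rmorph0 rmorph_sum -[RHS]s0.
    by apply: eq_bigr => j _; rewrite rmorphM cE.
  rewrite mulf_eq0 => /orP[/eqP->|/eqP Xi]; first by rewrite rmorph0.
  by case/negP: X0; rewrite -Xi mem_nth ?size_tuple.
move=> _ [y Vy ->]; move: Vy; rewrite -{1}defV => /memv_sumP[v vU ->].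
have /fin_all_exists2[u uU vE] : forall i : 'I_m, exists2 u, u \in U & v i = u * X`_i.
  by move=> i; apply/memv_cosetP/vU.
exists (fun i => LC (u i)); split=> [i|]; first exact/imageCP.
by rewrite rmorph_sum; apply: eq_bigr => i _; rewrite vE rmorphM.
Qed.

(** A basis in the sense of [field_degree] decomposes [V] as the direct sum of the [U * <[f i]>],
    each of dimension [\dim U]. *)
Lemma field_degree_unique U V d : (U <= V)%VS ->
  field_degree (imageC V) (imageC U) d -> d = \dim_U V.
Proof.
move=> sUV [e [/fin_all_exists2[f fV eE] eI eS]].
have f0 i : f i != 0.
  apply/eqP=> fi0.
  suff : (if i == i then 1 else 0 : algC) = 0 by rewrite eqxx => /eqP; rewrite oner_eq0.
  apply: (eI (fun j => if j == i then 1 else 0)) => [j|].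
    by have [? ? _ _ _] := imageC_subfield U; case: ifP.
  by rewrite (bigD1 i) //= eqxx eE fi0 rmorph0 mulr0 add0r big1 // => j /negPf->; rewrite mul0r.
have defV : (\sum_(i < d) U * <[f i]>)%VS = V.
  apply/eqP; rewrite eqEsubv; apply/andP; split.
    apply/subv_sumP=> i _; apply/prodvP=> u _ Uu /vlineP[a ->].
    by rewrite memvM // ?memvZ // (subvP sUV).
  apply/subvP=> y Vy; have [c [/fin_all_exists2[u uU cE] yE]] := eS (LC y) (proj2 (imageCP V y) Vy).
  have -> : y = \sum_i u i * f i.
    apply: (fmorph_inj LC); rewrite yE rmorph_sum; apply: eq_bigr => i _.
    by rewrite cE eE rmorphM.
  by apply: memv_sumr => i _; rewrite memv_mul // memv_line.
have dirV : directv (\sum_(i < d) U * <[f i]>)%VS.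
  apply/directv_sum_independent=> us usU us0 i _.
  have /fin_all_exists2[u uU uE] : forall i : 'I_d, exists2 u, u \in U & us i = u * f i.
    by move=> j; apply/memv_cosetP/usU.
  rewrite uE; suff -> : u i = 0 by rewrite mul0r.
  apply: (fmorph_inj LC); rewrite rmorph0; apply: (eI (fun j => LC (u j))) => [j|].
    exact/imageCP.
  transitivity (LC (\sum_j us j)); last by rewrite us0 rmorph0.
  by rewrite rmorph_sum; apply: eq_bigr => j _; rewrite uE eE rmorphM.
have := directvP dirV; rewrite /= defV => ->.
rewrite (eq_bigr (fun _ => \dim U)) => [|i _]; last by rewrite dim_cosetv.
by rewrite sum_nat_const card_ord mulnK ?adim_gt0.
Qed.

End NumberField.

(** * Degrees of adjunctions and their valuations *)

Lemma nat_ivt (f : nat -> nat) a M b :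
    (a <= M)%N -> (f a <= b)%N -> (b <= f M)%N ->
    (forall N, (a <= N < M)%N -> (f N.+1 <= (f N).+1)%N) ->
  exists2 N, (a <= N <= M)%N & f N = b.
Proof.
move=> aM fa fM fS.
have ex : exists N, (a <= N <= M)%N && (b <= f N)%N by exists M; rewrite aM leqnn.
(* Take the least such [N]. Either it is [a], or its predecessor has value below [b] and the step
   bound applies. *)
case: (ex_minnP ex) => N /andP[/andP[aN NM] bN] Nmin.
exists N; first by rewrite aN.
apply/eqP; rewrite eqn_leq bN andbT.
move: aN; rewrite leq_eqVlt => /orP[/eqP <- //|].
case: N NM bN Nmin => // N NM bN Nmin aN.
apply: leq_trans (fS N _) _; first by rewrite -ltnS aN.
rewrite ltnNge; apply/negP => bN'.
by have := Nmin N; rewrite bN' -ltnS aN (ltnW NM) ltnn => /(_ isT).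
Qed.

(** The minimal polynomials of [x] and of [LC x] have the same size by mutual divisibility, and the
    second is cyclotomic. *)
Lemma dim_prim_root (L : fieldExtType rat) (LC : {rmorphism L -> algC}) m (x : L) :
  m.-primitive_root x -> \dim <<1; x>> = totient m.
Proof.
move=> xP; have LxP : m.-primitive_root (LC x) by rewrite fmorph_primitive_root.
have [q [qE q_monic] qdvd] := minCpolyP (LC x).
have sq : size q = (totient m).+1.
  by rewrite -(size_map_poly (ratr : {rmorphism rat -> algC})) -qE
    (minCpoly_cyclotomic LxP) size_cyclotomic.
have rootE (r : {poly rat}) : root (map_poly (in_alg L) r) x = root (map_poly ratr r) (LC x).
  rewrite -(fmorph_root LC) -map_poly_comp; congr (root _ _); apply: eq_map_poly => a /=.
  by rewrite rmorphZ_num rmorph1 mulr1.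
rewrite dim_Fadjoin dimv1 muln1; apply: succn_inj; rewrite -size_minPoly -sq.
apply/eqP; rewrite eqn_leq; apply/andP; split.
  rewrite -(size_map_poly (in_alg L) q); apply: dvdp_leq.
    by rewrite map_poly_eq0 monic_neq0.
  by apply: minPoly_dvdp; [exact: alg_polyOver | rewrite rootE qdvd].
have /polyOver1P[r rE] := minPolyOver 1%AS x.
rewrite rE size_map_poly; apply: dvdp_leq.
  by rewrite -(map_poly_eq0 (in_alg L)) -rE monic_neq0 ?monic_minPoly.
by rewrite -qdvd -rootE -rE root_minPoly.
Qed.

(** The existence theorem takes a group whose order fixes the order of the root of unity;
    ['I_n.-1.+1] is one of order [n]. The last clause links the Galois group of [L] with
    automorphisms of [algC]. *)
Lemma cyclotomic_field_exists n : (0 < n)%N ->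
  exists (L : splittingFieldType rat) (LC : {rmorphism L -> algC}) (w : L),
    [/\ galois 1 {:L}, n.-primitive_root w
      & forall g : gal_of {:L},
          exists nu : {rmorphism algC -> algC}, forall a, LC (g a) = nu (LC a)].
Proof.
move=> n_gt0.
have [L galL [LC lift [w [wP _] _]]] := group_num_field_exists [set: 'I_n.-1.+1]%G.
exists L, LC, w; split=> // [|g]; first by rewrite cardsT card_ord prednK in wP.
by have [nu nuE] := lift g; exists nu.
Qed.

Lemma adjoin_degree_bound (F : fieldType) (L : fieldExtType F) (U : {subfield L}) x (P : {poly L}) :
  P \is a polyOver U -> root P x -> P != 0 -> (\dim_U <<U; x>> <= (size P).-1)%N.
Proof.
move=> PU Px P0; rewrite dim_Fadjoin mulnK ?adim_gt0 //.
have := dvdp_leq P0 (minPoly_dvdp PU Px).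
by rewrite size_minPoly; case: (size P).
Qed.

Lemma dimv_tower (F : fieldType) (L : fieldExtType F) (U V W : {subfield L}) :
  (U <= V)%VS -> (V <= W)%VS -> \dim_U W = (\dim_V W * \dim_U V)%N.
Proof.
move=> UV VW; apply/eqP; rewrite -(eqn_pmul2r (adim_gt0 U)) -mulnA.
by rewrite -!dim_sup_field ?(subv_trans UV).
Qed.

Lemma dim_sup_field_gt0 (F : fieldType) (L : fieldExtType F) (U V : {subfield L}) :
  (U <= V)%VS -> (0 < \dim_U V)%N.
Proof. by move=> UV; rewrite divn_gt0 ?adim_gt0 ?dimvS. Qed.

Lemma adjoin_pexpr_degree (F : fieldType) (L : fieldExtType F) (U : {subfield L}) x p :
  (0 < p)%N -> x ^+ p \in U -> (\dim_U <<U; x>> <= p)%N.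
Proof.
move=> p_gt0 xpU; have sP : size ('X^p - (x ^+ p)%:P) = p.+1 by rewrite size_XnsubC.
apply: leq_trans (adjoin_degree_bound _ _ _ _ ('X^p - (x ^+ p)%:P) _ _ _) _.
- by rewrite rpredB ?rpredX ?polyOverX ?polyOverC.
- by rewrite rootE !hornerE subrr.
- by rewrite -size_poly_gt0 sP.
by rewrite sP.
Qed.

Lemma adjoin_prim_root_degree (F : fieldType) (L : fieldExtType F) (U : {subfield L}) x p :
  prime p -> p.-primitive_root x -> (\dim_U <<U; x>> < p)%N.
Proof.
(* This is [(X^p - 1) / (X - 1)], of degree [p - 1]. *)
move=> pr_p xP; pose P : {poly L} := \poly_(i < p) 1.
have sP : size P = p by rewrite size_poly_eq ?oner_eq0.
apply: leq_ltn_trans (adjoin_degree_bound _ _ _ _ P _ _ _) _.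
- by apply/polyOverP=> i; rewrite coef_poly; case: ifP; rewrite ?mem0v ?mem1v.
- rewrite rootE horner_poly; have x1 : x - 1 != 0.
    rewrite subr_eq0; apply: contraL (prime_gt1 pr_p) => /eqP x1.
    by rewrite -leqNgt dvdn_leq // (prim_order_dvd xP) x1 expr1.
  apply/eqP/(mulfI x1); rewrite mulr0 (eq_bigr (fun i : 'I_p => x ^+ i)).
    by rewrite -subrX1 (prim_expr_order xP) subrr.
  by move=> i _; rewrite mul1r.
- by rewrite -size_poly_gt0 sP prime_gt0.
by rewrite sP prednK ?prime_gt0.
Qed.

Lemma logn_lt p d : (0 < d)%N -> (d < p)%N -> logn p d = 0%N.
Proof.
move=> d0 dp; rewrite lognE; case: and3P => // -[_ _ /(dvdn_leq d0)].
by rewrite leqNgt dp.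
Qed.

Lemma logn_le1 p d : (0 < d)%N -> (d <= p)%N -> (logn p d <= 1)%N.
Proof.
move=> d0; rewrite leq_eqVlt => /orP[/eqP-> | /(logn_lt p d d0)->//].
by case pr_p: (prime p); [rewrite logn_prime ?eqxx | rewrite lognE pr_p].
Qed.

(** * Galois theory and adjunction of roots of unity inside a cyclotomic field *)

Section CyclotomicField.

Variables (L : splittingFieldType rat) (LC : {rmorphism L -> algC}) (n : nat) (w : L).
Hypotheses (galL : galois 1 {:L}) (wP : n.-primitive_root w).
Hypothesis liftL : forall g : gal_of {:L},
  exists nu : {rmorphism algC -> algC}, forall a, LC (g a) = nu (LC a).
Implicit Types (U V : {subfield L}).
Local Notation imC := (imageC L LC).

Lemma restrict_aut (nu : {rmorphism algC -> algC}) :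
  exists g : gal_of {:L}, forall a, LC (g a) = nu (LC a).
Proof.
have [nu0 nuE] := restrict_aut_to_normal_num_field LC nu.
exists (gal {:L} (AHom (linfun_is_ahom nu0))) => a.
by rewrite galK ?subvf ?memvf //= lfunE nuE.
Qed.

(** The Galois correspondence for [{:L}] over [U], phrased with the automorphisms of [algC] because
    these act on character values. *)
Lemma aut_fixed_mem U y :
    (forall s : {rmorphism algC -> algC},
       (forall x, x \in U -> s (LC x) = LC x) -> s (LC y) = LC y) ->
  y \in U.
Proof.
move=> fixy; have galU : galois U {:L} by apply: galoisS galL; rewrite sub1v subvf.
have /galois_fixedField <- := galU; apply/fixedFieldP; first exact: memvf.
move=> g gU; have [nu nuE] := liftL g.
apply: (fmorph_inj LC); rewrite nuE fixy // => x Ux.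
by rewrite -nuE (fixed_gal _ gU) ?subvf.
Qed.

Definition root_of_w m := w ^+ (n %/ m).

Lemma root_of_wP m : (m %| n)%N -> m.-primitive_root (root_of_w m).
Proof. exact: dvdn_prim_root. Qed.

Lemma LC_rootP m x : (m %| n)%N -> x ^+ m = 1 -> exists i, x = LC (root_of_w m) ^+ i.
Proof.
move=> mn xm; have wmP : m.-primitive_root (LC (root_of_w m)).
  by rewrite fmorph_primitive_root root_of_wP.
by have [i ->] := prim_rootP wmP xm; exists i.
Qed.

Lemma Qcyc_imageC c x : (c %| n)%N -> Qcyc c x -> imageC L LC fullv x.
Proof.
move=> cn; apply; first exact: (imageC_subfield L LC {:L}%AS).
move=> z /(LC_rootP _ _ cn)[i ->]; rewrite -rmorphXn.
by apply/imageCP; rewrite memvf.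
Qed.

Lemma adjoin_rootsE (F : algC -> Prop) U m : (m %| n)%N ->
  (forall x, F x <-> imageC L LC U x) ->
  forall x, adjoin_roots F m x <-> imageC L LC <<U; root_of_w m>> x.
Proof.
move=> mn FU x; split=> [|[y yU ->]].
  apply; first exact: (imageC_subfield L LC <<U; root_of_w m>>%AS).
  move=> z [/FU[y Uy ->] | /(LC_rootP _ _ mn)[i ->]]; last rewrite -rmorphXn.
    by apply/imageCP; rewrite (subvP (subv_adjoin _ _)).
  by apply/imageCP; rewrite rpredX // memv_adjoin.
have [V VE] := subfieldC_preimage L LC _ (genfield_subfield (fun z => F z \/ z ^+ m = 1)).
apply/VE; have /subvP/(_ y yU) // : (<<U; root_of_w m>>%AS <= V)%VS.
apply/FadjoinP; split.
  by apply/subvP=> u Uu; apply/VE; apply: genfield_gen; left; apply/FU/imageCP.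
apply/VE; apply: genfield_gen; right.
by rewrite -rmorphXn (prim_expr_order (root_of_wP _ mn)) rmorph1.
Qed.

Lemma gal_root_of_w (f : {rmorphism L -> L}) m : (m %| n)%N ->
  exists i, f (root_of_w m) = root_of_w m ^+ i.
Proof.
move=> mn; have wmP := root_of_wP m mn.
have fm : f (root_of_w m) ^+ m = 1 by rewrite -rmorphXn (prim_expr_order wmP) rmorph1.
by have [i ->] := prim_rootP wmP fm; exists i.
Qed.

(** Automorphisms over [U] send the root of unity to one of its powers and so preserve the
    adjunction. *)
Lemma galois_adjoin_root U m : (m %| n)%N -> galois U <<U; root_of_w m>>.
Proof.
move=> mn; have galU : galois U {:L} by apply: galoisS galL; rewrite sub1v subvf.
apply: (normalField_galois galU); rewrite ?subvf ?subv_adjoin //.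
apply/forall_inP=> f; rewrite inE => /andP[/kHomP[_ fU] _].
have [i fw] := gal_root_of_w f m mn.
suff : kAut 1 <<U; root_of_w m>> f by case/andP.
rewrite kAut1E; apply/subvP=> _ /memv_imgP[y yU ->].
have [P PU ->] := Fadjoin_polyP yU; rewrite -horner_map fw.
apply: rpred_horner; last by rewrite rpredX // memv_adjoin.
apply/polyOverP=> j; rewrite coef_map /= fU ?(polyOverP PU) //.
by apply: (subvP (subv_adjoin _ _)); apply: (polyOverP PU).
Qed.

Lemma Qcyc_subfield_imageC (F : algC -> Prop) c :
    subfieldC F -> (c %| n)%N -> (forall x, F x -> Qcyc c x) ->
  exists U : {subfield L}, forall x, F x <-> imC U x.
Proof.
move=> sF cn Fc; have [U UE] := subfieldC_preimage L LC F sF.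
exists U => x; split=> [Fx|[y Uy ->]]; last exact/UE.
have [y _ xy] := Qcyc_imageC c x cn (Fc x Fx).
by rewrite xy in Fx *; apply/imageCP/UE.
Qed.

Lemma root_of_w_expr m k : (m * k %| n)%N -> (0 < k)%N -> root_of_w (m * k) ^+ k = root_of_w m.
Proof.
move=> /dvdnP[e nE] k0; rewrite /root_of_w -exprM nE; congr (_ ^+ _).
have [->|m0] := posnP m; first by rewrite !(mul0n, muln0) !div0n.
by rewrite mulnK ?muln_gt0 ?m0 // mulnA mulnAC mulnK // mulnC.
Qed.

Lemma adjoin_root_mono U m k : (m * k %| n)%N -> (0 < k)%N ->
  (<<U; root_of_w m>> <= <<U; root_of_w (m * k)>>)%VS.
Proof.
move=> mk k0; apply/FadjoinP; rewrite subv_adjoin; split=> //.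
by rewrite -(root_of_w_expr _ _ mk k0) rpredX // memv_adjoin.
Qed.

(** The upper layer is generated by a [p]-th root of an element of the lower field, so its degree is
    at most [p]. *)
Lemma logn_adjoin_step U p N : prime p -> (p ^ N.+1 %| n)%N ->
  (logn p (\dim_U <<U; root_of_w (p ^ N.+1)>>) <=
     (logn p (\dim_U <<U; root_of_w (p ^ N)>>)).+1)%N.
Proof.
move=> pr_p; rewrite expnSr => pNn; have p_gt0 := prime_gt0 pr_p.
pose W := <<U; root_of_w (p ^ N)>>%AS; pose W' := <<U; root_of_w (p ^ N * p)>>%AS.
have UW : (U <= W)%VS := subv_adjoin _ _.
have WW' : (W <= W')%VS by exact: adjoin_root_mono.
rewrite (dimv_tower _ _ U W W') // lognM ?dim_sup_field_gt0 // -addn1 addnC leq_add2l.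
apply: logn_le1; first exact: dim_sup_field_gt0.
have step : (\dim_W <<W; root_of_w (p ^ N * p)>> <= p)%N.
  by apply: adjoin_pexpr_degree; rewrite // root_of_w_expr // memv_adjoin.
apply: leq_trans step; apply/leq_div2r/dimvS/FadjoinP; split.
  exact: subv_trans UW (subv_adjoin _ _).
exact: memv_adjoin.
Qed.

(** The adjunction contains the cyclotomic field of order [p ^ N.+1], whose degree has [p]-part
    [p ^ N]; this degree divides that of the adjunction over the rationals. *)
Lemma logn_adjoin_lower U p N : prime p -> (p ^ N.+1 %| n)%N ->
  (N <= logn p (\dim_U <<U; root_of_w (p ^ N.+1)>>) + logn p (\dim U))%N.
Proof.
move=> pr_p pNn; pose W := <<U; root_of_w (p ^ N.+1)>>%AS.
have UW : (U <= W)%VS := subv_adjoin _ _.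
rewrite -lognM ?dim_sup_field_gt0 ?adim_gt0 // -(dim_sup_field UW).
have sW : (<<1; root_of_w (p ^ N.+1)>>%AS <= W)%VS.
  by apply/FadjoinP; rewrite sub1v memv_adjoin.
have := field_dimS sW; rewrite (dim_prim_root _ LC (p ^ N.+1)) ?root_of_wP // => dW.
apply: leq_trans (dvdn_leq_log p (adim_gt0 W) dW).
rewrite totient_pfactor // lognM ?expn_gt0 ?(prime_gt0 pr_p) //.
  by rewrite pfactorK // leq_addl.
by rewrite -subn1 subn_gt0 prime_gt1.
Qed.

Lemma logn_adjoin_prime U p : prime p -> (p %| n)%N ->
  logn p (\dim_U <<U; root_of_w p>>) = 0%N.
Proof.
move=> pr_p pn; apply: logn_lt; first exact: dim_sup_field_gt0 (subv_adjoin _ _).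
by apply: adjoin_prim_root_degree; rewrite ?root_of_wP.
Qed.

(** The values lie in the image of [L], being sums of [n]-th roots of unity divided by an integer.
    The automorphisms fixing the character are those fixing [U], so both inclusions follow from the
    Galois correspondence. *)
Lemma datum_character (gT : finGroupType) (B : {group gT}) lam U : (0 < n)%N ->
    monomial_datum gT B lam n (fun s t => forall x, imC U x -> s x = t x) ->
  exists i : Iirr [set: gT],
    'chi_i 1%g = #|[set: gT] : B|%g%:R /\
    (forall x, field_of_values 'chi_i x <-> imC U x).
Proof.
move=> n_gt0 dat; have [_ lamn _ _] := dat.
have [i [chi1 chiE chiR]] := induced_datum_char _ _ _ _ _ n_gt0 dat.
exists i; split=> //.
have sL := imageC_subfield L LC {:L}%AS; have [L0 _ _ LM LV] := sL.
have /fin_all_exists[v vE] g : exists y, 'chi_i g = LC y.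
  suff [y _ ->] : imC {:L} ('chi_i g) by exists y.
  rewrite chiE; apply: LM.
    by apply: LV; rewrite -(rmorph_nat LC); apply/imageCP; rewrite memvf.
  apply: (big_ind (imC {:L})) => // [x y|y _]; first exact: subfieldC_D.
  case: ifP => // /lamn /(LC_rootP n _ (dvdnn n))[j ->].
  by rewrite -rmorphXn; apply/imageCP; rewrite memvf.
move=> x; split=> [|[y Uy ->]].
  apply; first exact: imageC_subfield.
  move=> _ [g ->]; rewrite vE; apply/imageCP.
  apply: (aut_fixed_mem) => s sU; rewrite -vE.
  by apply: (proj1 (chiR s)) => _ [a Ua ->] /=; exact: sU.
have [V VE] := subfieldC_preimage L LC _ (genfield_subfield (fun z => exists g : gT, z = 'chi_i g)).
apply/VE; apply: (aut_fixed_mem) => s sV.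
have /chiR sU : forall g, s ('chi_i g) = 'chi_i g.
  move=> g; rewrite vE; apply: sV; apply/VE; rewrite -vE.
  by apply: genfield_gen; exists g.
by apply: sU; apply/imageCP.
Qed.

Lemma lift_gal U (u : gal_of U) :
  exists nu : {rmorphism algC -> algC}, forall a, LC (u a) = nu (LC a).
Proof.
have [nu nuE] := liftL (gal {:L} u); exists nu => a.
by rewrite -nuE galK ?subvf ?memvf.
Qed.

(** Here [h] is the restriction of the inverse of [t] after [s]; it is written [gs * gt^-1] since
    products in [gal_of] apply the left factor first. *)
Lemma agree_transport U (s t : {rmorphism algC -> algC}) :
    (forall x, imC U x -> s x = t x) ->
  exists2 h : gal_of {:L}, h \in 'Gal({:L} / U)%g & forall a, t (LC (h a)) = s (LC a).
Proof.
move=> st; have [gs gsE] := restrict_aut s; have [gt gtE] := restrict_aut t.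
have hE a : t (LC ((gs * gt^-1)%g a)) = s (LC a).
  rewrite -gsE -gtE -galM ?memvf // mulgKV //.
exists (gs * gt^-1)%g => //; rewrite gal_kHom ?subvf //; apply/kAHomP => a Ua.
apply: (fmorph_inj LC); apply: (fmorph_inj t); rewrite hE.
by apply: st; apply/imageCP.
Qed.

(** * A character with field of values [U] and prescribed valuation of the degree *)

Section Construction.

Variables (p c N m : nat) (U : {subfield L}).
Hypotheses (pr_p : prime p) (pm : coprime p m) (m_gt0 : (0 < m)%N)
  (pNn : (p ^ N %| n)%N) (mn : (m %| n)%N) (cNm : (c %| p ^ N * m)%N)
  (n_gt0 : (0 < n)%N).
Hypothesis Uc : forall x, imC U x -> Qcyc c x.

Local Notation W := <<U; root_of_w (p ^ N)>>%AS.

(** Both generators of [W], namely [U] and the [p ^ N]-th roots of unity, lie in the cyclotomic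
    field of order [p ^ N * m]. *)
Lemma agree_on_adjoin (s t : {rmorphism algC -> algC}) :
    s (LC (root_of_w (p ^ N))) = t (LC (root_of_w (p ^ N))) ->
    s (LC (root_of_w m)) = t (LC (root_of_w m)) ->
  forall x, imC W x -> s x = t x.
Proof.
move=> sN sm; have sK := agree_subfield s t; have [K0 K1 KB KM KV] := sK.
have agN z : z ^+ (p ^ N) = 1 -> s z = t z.
  by case/(LC_rootP _ _ pNn)=> i ->; rewrite [LHS]rmorphXn [RHS]rmorphXn /= sN.
have agm z : z ^+ m = 1 -> s z = t z.
  by case/(LC_rootP _ _ mn)=> i ->; rewrite [LHS]rmorphXn [RHS]rmorphXn /= sm.
have agNm z : z ^+ (p ^ N * m) = 1 -> s z = t z.
  move=> z1; have z0 : z != 0.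
    by apply: (root_of_unity_neq0 _ _ _ z1); rewrite muln_gt0 m_gt0 expn_gt0 prime_gt0.
  have pN_gt0 : (0 < p ^ N)%N by rewrite expn_gt0 prime_gt0.
  (* By Bezout [a * p ^ N = b * m + 1], so [z] is an [m]-th root of unity divided by a [p ^ N]-th
     one. *)
  have /(coprimeP _ pN_gt0)[[a b] /= ab] : coprime (p ^ N) m by rewrite coprimeXl.
  have abE : (a * p ^ N)%N = (b * m).+1.
    by rewrite -addn1 addnC -ab subnK // ltnW // -subn_gt0 ab.
  have -> : z = z ^+ (a * p ^ N) / z ^+ (b * m) by rewrite abE exprS mulfK ?expf_neq0.
  apply: KM; last apply: KV.
    by apply: agm; rewrite -exprM -mulnA mulnC exprM z1 expr1n.
  by apply: agN; rewrite -exprM -mulnA [(m * _)%N]mulnC mulnC exprM z1 expr1n.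
have agc x : Qcyc c x -> s x = t x.
  move=> xc; apply: (xc (fun y => s y = t y)) => // z zc; apply: agNm; case/dvdnP: cNm => k ->.
  by rewrite mulnC exprM zc expr1n.
move=> x; have [_] := adjoin_rootsE (imC U) U (p ^ N) pNn (fun=> iff_refl _) x.
move=> WA /WA xA; apply: (xA (fun y => s y = t y)) => // z [/Uc/agc | /agN] //.
Qed.

(** The Galois orbit over [W], listed without repetition since the torus parameters must be
    distinct; [k.+1] is its size. *)
Lemma orbit_root : exists k (y : 'I_k.+1 -> L), [/\ injective y,
  exists i, y i = root_of_w m,
  forall i, exists2 g, g \in 'Gal({:L} / W)%g & y i = g (root_of_w m)
  & forall g, g \in 'Gal({:L} / W)%g -> exists i, y i = g (root_of_w m)].
Proof.
pose r := undup [seq (g : gal_of {:L}) (root_of_w m) | g in 'Gal({:L} / W)%g].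
have rP a : reflect (exists2 g, g \in 'Gal({:L} / W)%g & a = g (root_of_w m)) (a \in r).
  by rewrite mem_undup; apply: imageP.
have r1 : root_of_w m \in r by apply/rP; exists 1%g; rewrite ?group1 ?gal_id.
have sz : size r = (size r).-1.+1 by rewrite prednK //; case: (r) r1.
have lt_r (i : 'I_(size r).-1.+1) : (i < size r)%N by apply: leq_trans (ltn_ord i) _; rewrite -sz.
have idx a : a \in r -> exists i : 'I_(size r).-1.+1, r`_i = a.
  move=> ra; have lt : (index a r < (size r).-1.+1)%N by rewrite -sz index_mem.
  by exists (Ordinal lt); rewrite nth_index.
exists (size r).-1, (fun i => r`_i); split.
- move=> i j /eqP; rewrite nth_uniq ?undup_uniq ?lt_r //.
  by move/eqP/val_inj.
- exact: idx.
- by move=> i; apply/rP; rewrite mem_nth ?lt_r.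
by move=> g gW; apply: idx; apply/rP; exists g.
Qed.

(** The cyclic factor detects the action on [p ^ N]-th roots of unity and the Borel factor the
    action on [m]-th ones up to ['Gal({:L} / W)]; together they detect the action on [W]. The cyclic
    factor has index 1. *)
Lemma datum_adjoin : exists (gT : finGroupType) (B : {group gT}) lam,
  monomial_datum gT B lam n (fun s t => forall x, imC W x -> s x = t x)
  /\ coprime p #|[set: gT] : B|%g.
Proof.
have [k [y [y_inj [i1 yi1] yG Gy]]] := orbit_root.
have ym i : LC (y i) ^+ m = 1.
  have [g _ ->] := yG i.
  by rewrite -!rmorphXn (prim_expr_order (root_of_wP _ mn)) !rmorph1.
have z_inj : injective (LC \o y) by apply: inj_comp y_inj; exact: fmorph_inj.
have [gT [B [lam [dat idx]]]] :=
  borel_datum_exists p m n k (LC \o y) pr_p pm m_gt0 mn z_inj ym.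
have pN_gt0 : (0 < p ^ N)%N by rewrite expn_gt0 prime_gt0.
have wN : LC (root_of_w (p ^ N)) ^+ (p ^ N).-1.+1 = 1.
  by rewrite prednK // -rmorphXn (prim_expr_order (root_of_wP _ pNn)) rmorph1.
have pNn' : ((p ^ N).-1.+1 %| n)%N by rewrite prednK.
have cdat := monomial_datum_dvd _ _ _ _ n _ pNn' (cyclic_datum _ _ wN).
have := product_datum _ _ _ _ _ _ _ _ _ n_gt0 cdat dat.
set pdat := monomial_datum _ _ _ _ _ => pd.
do 3!eexists; split; first apply: monomial_datum_iff pd => s t; last first.
  by rewrite index_setX indexgg mul1n.
split=> [[sN sm] | st]; last first.
  split; first by apply: st; apply/imageCP; rewrite memv_adjoin.
  move=> i; have [g gW yi] := yG i; have [h hW hE] := agree_transport _ _ _ st.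
  have [j yj] := Gy _ (groupM gW hW); exists j.
  by rewrite /= yj galM ?memvf // hE yi.
(* On the [m]-th root, [s] agrees with [t] preceded by some [g] fixing [W]. With the lift [kappa] of
   [g], the maps [s] and [t \o kappa] agree on both roots, hence on [W], where [kappa] is the
   identity. *)
have [j] := sm i1; rewrite /= yi1; have [g gW ->] := yG j.
have [kappa kE] := liftL g; rewrite kE => smm x Wx.
have kW a : a \in W -> kappa (LC a) = LC a.
  by move=> Wa; rewrite -kE (fixed_gal _ gW) ?subvf.
rewrite (agree_on_adjoin s (t \o kappa) _ smm x Wx) /=.
  by case: Wx => a Wa ->; rewrite kW.
by rewrite sN kW // memv_adjoin.
Qed.

(** The degree is the order of ['Gal(W / U)], that is [\dim_U W], times a power of an index prime to
    [p]. *)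
Lemma character_of_field : exists (gT : finGroupType) (G : {group gT}) (i : Iirr G),
  (forall x, field_of_values 'chi_i x <-> imC U x) /\
  logn p (Num.truncn ('chi_i 1%g)) = logn p (\dim_U W).
Proof.
have [gT [B [lam [dat idx]]]] := datum_adjoin.
have galW := galois_adjoin_root U (p ^ N) pNn.
have UW : (U <= W)%VS := subv_adjoin _ _.
pose Q := subg_of 'Gal(W / U)%G.
have /fin_all_exists[sig sigE] (u : Q) : exists nu : {rmorphism algC -> algC},
    forall a, LC ((sgval u : gal_of W) a) = nu (LC a) by exact: lift_gal.
have datW := wreath_datum gT Q B lam n _ n_gt0 dat sig
  (fun s t => forall x, imC U x -> s x = t x).
case: (datum_character (wreath gT Q) (wreath_subG gT Q B)
   (wreath_lam gT Q lam sig) U n_gt0); last first.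
  move=> i [chi1 chiU]; exists (wreath gT Q), [set: wreath gT Q]%G, i; split=> //.
  rewrite chi1 natrK.
  rewrite index_wreath.
  have gt0 : (0 < #|[set: gT] : B|%g)%N := indexg_gt0 _ _.
  rewrite lognM ?expn_gt0 ?gt0 //; last by apply/card_gt0P; exists 1%g.
  rewrite lognX logn_coprime // muln0 add0n galois_dim //.
  by rewrite card_sub.
apply: datW => [u v Ruv|s t st|s t u v Ruv x [a Ua ->]].
- apply: val_inj; apply/eqP/gal_eqP => a Wa; apply: (fmorph_inj LC).
  by rewrite !sigE; apply: Ruv; apply/imageCP.
- have [h hU hE] := agree_transport _ _ _ st.
  have nW : normalField U W by case/and3P: galW.
  have sUWL : (U <= W <= {:L})%VS by rewrite UW subvf.
  (* The restriction of [h] to the normal field [W] is the translation of coordinates asked for by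
     [wreath_datum]. *)
  have hW := normalField_cast_eq sUWL nW hU; set v0 := normalField_cast _ _ in hW.
  have v0G : v0 \in 'Gal(W / U)%g.
    rewrite gal_kHom //; apply/kAHomP=> a Ua.
    by rewrite hW ?(subvP UW) // (fixed_gal _ hU) ?subvf.
  exists (subg _ v0) => u _ [a Wa ->] /=.
  by rewrite /= -!sigE /= subgK // galM // hW ?memv_gal //.
have := Ruv (LC a); rewrite /= -!sigE !(fixed_gal UW (subgP _) Ua); apply.
by apply/imageCP; rewrite (subvP UW).
Qed.

End Construction.

End CyclotomicField.

(** * The criterion for fields of values *)

Theorem theoremB (p : nat) (pr_p : prime p)
  (Hyp : forall (hT : finGroupType) (H : {group hT}) (j : Iirr H) (c' : nat),
     is_conductor (field_of_values 'chi[H]_j) c' ->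
     (1 <= logn p c')%N ->
     exists d : nat,
       field_degree (adjoin_roots (field_of_values 'chi[H]_j) (p ^ logn p c'))
                    (adjoin_roots (field_of_values 'chi[H]_j) p) d
       /\ (d %| Num.truncn ('chi[H]_j 1%g))%N)
  (F : algC -> Prop) (abF : abelian_ext F) (c : nat) (cF : is_conductor F c)
  (b : nat) :
  (exists (gT : finGroupType) (G : {group gT}) (i : Iirr G),
      (forall x, field_of_values 'chi[G]_i x <-> F x)
      /\ logn p (Num.truncn ('chi[G]_i 1%g)) = b)
  <->
  (exists d : nat,
      field_degree (adjoin_roots F (p ^ logn p c)) F d /\ (logn p d <= b)%N).
Proof.
have [sF [e Fe] _ _] := abF; have [c_gt0 Fc cmin] := cF.
have p_gt0 := prime_gt0 pr_p; set a := logn p c.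
split=> [[gT [G [i [FE <-]]]] | [d [Fd db]]].
  (* The factor [p] provides [p]-th roots of unity in [L] even when [p] does not divide [c]. *)
  have n_gt0 : (0 < c * p)%N by rewrite muln_gt0 c_gt0.
  have [L [LC [w [galL wP lift]]]] := cyclotomic_field_exists _ n_gt0.
  have [U FU] := Qcyc_subfield_imageC L LC _ w wP F c sF (dvdn_mulr _ (dvdnn c)) Fc.
  have pn : (p %| c * p)%N := dvdn_mull _ (dvdnn p).
  have pan : (p ^ a %| c * p)%N by apply: dvdn_mulr; exact: pfactor_dvdnn.
  have adjE m (mn : (m %| c * p)%N) := adjoin_rootsE L LC _ w wP F U m mn FU.
  pose W := <<U; root_of_w L (c * p) w (p ^ a)>>%AS.
  have UW : (U <= W)%VS := subv_adjoin _ _.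
  exists (\dim_U W); split.
    apply: eq_field_degree (field_degree_dim L LC U W UW) => x; apply: iff_sym.
      exact: adjE.
    exact: FU.
  (* The hypothesis on characters says nothing for [a = 0], but then a root of unity of order 1 is
     adjoined and the degree is 1. *)
  have [a0|a_gt0] := posnP a.
    rewrite (logn_lt p (\dim_U W)) // ?dim_sup_field_gt0 //.
    apply: leq_ltn_trans (prime_gt1 pr_p); rewrite -[1%N](expn0 p) -a0.
    apply: adjoin_pexpr_degree; rewrite ?expn_gt0 ?p_gt0 //.
    by rewrite (prim_expr_order (root_of_wP _ _ _ wP _ pan)) mem1v.
  pose V := <<U; root_of_w L (c * p) w p>>%AS.
  have UV : (U <= V)%VS := subv_adjoin _ _.
  have VW : (V <= W)%VS.
    have := adjoin_root_mono L _ w U p (p ^ a.-1); rewrite -expnS prednK //.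
    by apply; rewrite ?expn_gt0 ?p_gt0.
  have [|//|d [dWV ddvd]] := Hyp gT G i c.
    split=> // [x /FE/Fc // | m m_gt0 Fm]; apply: cmin => // x /FE; exact: Fm.
  have FVE := adjE p pn; have FWE := adjE (p ^ a)%N pan.
  have FG m x : adjoin_roots (field_of_values 'chi_i) m x <-> adjoin_roots F m x.
    by apply: eq_genfield => z; rewrite FE.
  have dE : d = \dim_V W.
    apply: (field_degree_unique L LC V W d VW); apply: eq_field_degree dWV => x.
      exact: iff_trans (FG _ x) (FWE x).
    exact: iff_trans (FG _ x) (FVE x).
  (* The degree of [W] over [V] divides that of the character, and the degree of [V] over [U] is
     less than [p]. *)
  rewrite (dimv_tower _ _ U V W) // lognM ?dim_sup_field_gt0 //.
  rewrite (logn_adjoin_prime L _ w wP U p) // addn0 -dE.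
  apply: dvdn_leq_log ddvd; rewrite lt0n; apply/eqP=> chi0.
  have := irr1_gt0 i; have /natrP[k chiE] : 'chi_i 1%g \is a Num.nat by exact: Cnat_irr1.
  by move: chi0; rewrite chiE natrK => ->; rewrite Order.POrderTheory.ltxx.
(* The successor offsets the shift in [logn_adjoin_lower], and [logn p e] the valuation of the
   degree of [F] over the rationals; the valuation at [M] is then at least [b]. *)
pose M := (a + b + logn p e).+1.
have n_gt0 : (0 < c * p ^ M)%N by rewrite muln_gt0 c_gt0 expn_gt0 p_gt0.
have [L [LC [w [galL wP lift]]]] := cyclotomic_field_exists _ n_gt0.
have cn : (c %| c * p ^ M)%N by apply: dvdn_mulr.
have pNn N : (N <= M)%N -> (p ^ N %| c * p ^ M)%N.
  by move=> NM; apply/dvdn_mull/dvdn_exp2l.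
have [U FU] := Qcyc_subfield_imageC L LC _ w wP F c sF cn Fc.
pose f N := logn p (\dim_U <<U; root_of_w L (c * p ^ M) w (p ^ N)>>).
have aM : (a <= M)%N by apply: leqW; rewrite -addnA leq_addr.
have fa : (f a <= b)%N.
  rewrite /f -(field_degree_unique L LC U _ d (subv_adjoin _ _)) //.
  apply: eq_field_degree Fd => //.
  exact: (adjoin_rootsE L LC _ w wP F U _ (pNn a aM) FU).
have dimU : e = \dim U.
  have := field_degree_unique L LC 1%AS U e (sub1v _); rewrite dimv1 divn1; apply.
  apply: eq_field_degree Fe => //; exact: imageC_1.
have fM : (b <= f M)%N.
  have := logn_adjoin_lower L LC _ w wP U p (a + b + logn p e) pr_p (pNn M (leqnn M)).
  by rewrite /f -dimU leq_add2r; apply: leq_trans; exact: leq_addl.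
have [N /andP[aN NM] fN] : exists2 N, (a <= N <= M)%N & f N = b.
  apply: nat_ivt => // N /andP[_ NM].
  by apply: logn_adjoin_step => //; apply: pNn.
(* The part of [c] prime to [p] serves as [m]; since [a <= N], [c] divides [p ^ N * m]. *)
have cE : (c = p ^ a * c`_p^')%N by rewrite -p_part partnC.
have pm : coprime p c`_p^'.
  by rewrite -[p in coprime p _]expn1 (pnat_coprime (pnat_id pr_p)) ?part_pnat.
have [||||gT [G [i [chiU chi1]]]] :=
  character_of_field L LC _ w galL wP lift p c N c`_p^' U pr_p pm (part_gt0 _ _) (pNn N NM).
- by apply: dvdn_trans cn; rewrite dvdn_part.
- by rewrite {1}cE dvdn_mul // dvdn_exp2l.
- exact: n_gt0.
- by move=> x /FU/Fc.
exists gT, G, i; rewrite chi1; split=> // x.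
by apply: iff_trans (chiU x) (iff_sym (FU x)).
Qed.
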